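(* Let $n\ge 1$ and $d\ge 1$ be integers and let $\mathsf{M}$ be a connected matroid of rank $d+1$ on the ground set $\llbracket n\rrbracket=\{0,1,\ldots,n\}$, with rank function $\rho$. Then the normalised volume of its base polytope $P_\mathsf{M}=\mathrm{conv}\{\sum_{i\in B}\mathbf{e}_i : B \text{ a basis of } \mathsf{M}\}\subseteq\mathbb{R}^{n+1}$ is \[ \mathrm{Vol}(P_\mathsf{M})=\frac{1}{n!}\sum_{\mathcal{F}}\mu(\mathcal{F})\,\delta_{\preceq}(\mathbf{b}_{\mathcal{F}}), \] where the sum runs over all anchored chains $\mathcal{F}$ of cyclic flats of $\mathsf{M}$.
   Context: Normalised volume $\mathrm{Vol}(P)$: the volume of $P$ in its affine hull, normalised so that the unit hypercube in $\mathrm{aff}(P)$ has volume $1$. A cyclic flat of $\mathsf{M}$ is a flat that is a union of circuits (the empty set included); since $\mathsf{M}$ is connected, $\varnothing$ and $\llbracket n\rrbracket$ are cyclic flats. An anchored chain of cyclic flats is a chain $\mathcal{F}:\varnothing=F_0\subsetneq F_1\subsetneq\cdots\subsetneq F_k\subsetneq F_{k+1}=\llbracket n\rrbracket$ ($k\ge 0$) of cyclic flats. Let $\Gamma$ be the set of anchored chains of cyclic flats ordered by refinement ($\mathcal{F}\le\mathcal{G}$ iff every set in $\mathcal{G}$ occurs in $\mathcal{F}$); its top element is the chain $\varnothing\subsetneq\llbracket n\rrbracket$. Let $\hat\Gamma$ be $\Gamma$ with a new bottom element $\hat 0$ adjoined, and set $\mu(\mathcal{F}):=-\mu_{\hat\Gamma}(\hat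 0,\mathcal{F})$, where $\mu_{\hat\Gamma}$ is the Möbius function of $\hat\Gamma$. For such a chain, $\mathbf{b}_\mathcal{F}$ is the binary sequence of length $n+1$ obtained by concatenating, for $i=1,\ldots,k+1$, the block $1^{\rho(F_i)-\rho(F_{i-1})}0^{(|F_i|-|F_{i-1}|)-(\rho(F_i)-\rho(F_{i-1}))}$. Let $L_d(n)$ be the set of binary sequences $(b_0,\ldots,b_n)$ with exactly $d+1$ ones, $b_0=1$ and $b_n=0$, partially ordered by $\mathbf{a}\preceq\mathbf{b}$ iff $\sum_{i=0}^j a_i\le\sum_{i=0}^j b_i$ for all $j$. For a permutation $w=w_1\cdots w_n$ of $[n]=\{1,\ldots,n\}$, its descent sequence is $\mathrm{des}(w)=(d_0,\ldots,d_n)$ with $d_0=1$, $d_n=0$, and for $1\le i\le n-1$, $d_i=1$ if $w_i>w_{i+1}$ and $d_i=0$ otherwise. For $\mathbf{a}\in L_d(n)$, $\delta(\mathbf{a})$ is the number of permutations of $[n]$ with descent sequence $\mathbf{a}$, and $\delta_\preceq(\mathbf{b}):=\sum_{\mathbf{a}\in L_d(n),\,\mathbf{a}\preceq\mathbf{b}}\delta(\mathbf{a})$. *)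

(* Defs.v *)
From HB Require Import structures.
From mathcomp Require Import all_boot all_order all_algebra all_fingroup.

Set Implicit Arguments.
Unset Strict Implicit.
Unset Printing Implicit Defensive.

(** * Matroids *)

Section Matroid.

Variable E : finType.

Record matroid := Matroid {
  bases : {set {set E}};
  bases_neq0 : bases != set0;
  bases_exchange : forall A B, A \in bases -> B \in bases ->
    forall x, x \in A :\: B ->
    exists2 y, y \in B :\: A & (y |: (A :\ x)) \in bases
}.

Variable M : matroid.

Definition indep (A : {set E}) : bool := [exists B in bases M, A \subset B].

Definition rank (A : {set E}) : nat :=
  \max_(I : {set E} | (I \subset A) && indep I) #|I|.

Definition matroid_rank : nat := rank [set: E].

Definition circuit (C : {set E}) : bool := minset (fun A => ~~ indep A) C.

Definition matroid_connected : Prop :=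
  forall x y : E, x != y -> exists C : {set E}, [/\ circuit C, x \in C & y \in C].

Definition flat (F : {set E}) : bool :=
  [forall x, (x \notin F) ==> (rank F < rank (x |: F))].

Definition cyclic_flat (F : {set E}) : bool :=
  flat F && (F == \bigcup_(C : {set E} | circuit C && (C \subset F)) C).

(* A chain [set0 = F_0 < F_1 < ... < F_k < F_(k+1) = E] is encoded as the set
   [{F_0, ..., F_(k+1)}] of its members. *)
Definition is_anchored_chain (F : {set {set E}}) : bool :=
  [&& set0 \in F, [set: E] \in F,
      [forall A in F, cyclic_flat A] &
      [forall A in F, forall B in F, (A \subset B) || (B \subset A)]].

Record anchored_chain := AnchoredChain {
  chain_set :> {set {set E}};
  chain_setP : is_anchored_chain chain_set
}.

HB.instance Definition _ := [isSub for chain_set].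
HB.instance Definition _ := [Finite of anchored_chain by <:].

Definition chain_refines (F G : anchored_chain) : bool :=
  chain_set G \subset chain_set F.

(* [None] is the adjoined bottom element. *)
Definition hat_le (x y : option anchored_chain) : bool :=
  match x, y with
  | None, _ => true
  | Some _, None => false
  | Some F, Some G => chain_refines F G
  end.

(* Members of a chain have distinct cardinalities, so sorting by cardinality
   lists [F_0, ..., F_(k+1)] in order. *)
Definition chain_seq (F : anchored_chain) : seq {set E} :=
  sort (fun A B : {set E} => #|A| <= #|B|) (enum (chain_set F)).

Definition bin_block (A B : {set E}) : seq bool :=
  nseq (rank B - rank A) true
    ++ nseq ((#|B| - #|A|) - (rank B - rank A)) false.

Definition chain_bin (F : anchored_chain) : seq bool :=
  flatten (pairmap bin_block set0 (behead (chain_seq F))).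

End Matroid.

(** * Moebius function of a finite poset *)

Section Moebius.

Local Open Scope ring_scope.

Variables (T : finType) (le : rel T).

Fixpoint mobius_rec (k : nat) (x y : T) : int :=
  if k is k'.+1 then
    if x == y then 1
    else if le x y then - \sum_(z | [&& le x z, le z y & z != y]) mobius_rec k' x z
    else 0
  else 0.

(* The fuel [#|T|] is large enough: see [mobiusE]. *)
Definition mobius (x y : T) : int := mobius_rec #|T| x y.

Lemma mobiusE : reflexive le -> antisymmetric le -> transitive le ->
  forall x y, mobius x y =
    if x == y then 1
    else if le x y then - \sum_(z | [&& le x z, le z y & z != y]) mobius x z
    else 0.
Proof.
move=> rle ale tle.
pose h y := #|[pred z | le z y]|.
have h_gt0 y : (0 < h y)%N by apply/card_gt0P; exists y; rewrite inE rle.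
have h_lt z y : le z y -> z != y -> (h z < h y)%N.
  move=> zy nzy; apply: proper_card; apply/properP; split.
    by apply/subsetP => t; rewrite !inE => /tle; apply.
  exists y; rewrite !inE ?rle //; apply: contra nzy => yz.
  by apply/eqP/ale; rewrite zy yz.
have fuel k l x y : (h y <= k)%N -> (h y <= l)%N ->
    mobius_rec k x y = mobius_rec l x y.
  elim: k l y => [|k IH] [|l] y; rewrite ?leqn0 => hk hl //.
  - by have := h_gt0 y; rewrite (eqP hk).
  - by have := h_gt0 y; rewrite (eqP hl).
  rewrite /=; case: eqP => // _; case: ifP => // _; congr (- _).
  apply: eq_bigr => z /and3P[_ zy nzy]; apply: IH.
    by rewrite -ltnS; apply: leq_trans (h_lt _ _ zy nzy) hk.
  by rewrite -ltnS; apply: leq_trans (h_lt _ _ zy nzy) hl.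
move=> x y.
have -> : mobius x y = mobius_rec #|T|.+1 x y.
  by apply: fuel; [exact: max_card | exact: leqW (max_card _)].
by [].
Qed.

End Moebius.

Definition chain_mu (E : finType) (M : matroid E) (F : anchored_chain M) : int :=
  (- mobius (@hat_le E M) None (Some F))%R.

(** * Descent sequences *)

Definition perm_word (n : nat) (w : 'S_n) : seq nat :=
  [seq (w i).+1 | i <- enum 'I_n].

(* With [w = w_1 ... w_n], the letter [w_i] is [nth 0 (perm_word w) i.-1]. *)
Definition descent_seq (n : nat) (w : 'S_n) : seq bool :=
  mkseq (fun i => if i == 0 then true
                  else if i == n then false
                  else nth 0 (perm_word w) i < nth 0 (perm_word w) i.-1) n.+1.

Definition delta (n : nat) (a : n.+1.-tuple bool) : nat :=
  #|[set w : 'S_n | descent_seq w == a]|.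

Definition in_L (d n : nat) (a : n.+1.-tuple bool) : bool :=
  [&& count id a == d.+1, nth false a 0 & ~~ nth false a n].

Definition bin_le (n : nat) (a b : seq bool) : bool :=
  [forall j : 'I_n.+1,
    \sum_(i < j.+1) nth false a i <= \sum_(i < j.+1) nth false b i].

Definition delta_le (d n : nat) (b : seq bool) : nat :=
  \sum_(a : n.+1.-tuple bool | in_L d a && bin_le n a b) delta a.

(** * Polytopes and normalised volume *)

From mathcomp Require Import all_classical all_reals all_analysis.

Local Open Scope classical_set_scope.
Local Open Scope ring_scope.

Section Volume.

Variable R : realType.

Definition conv_hull (N : nat) (A : set 'rV[R]_N) : set 'rV[R]_N :=
  [set x | exists (k : nat) (c : 'I_k -> R) (p : 'I_k -> 'rV[R]_N),
    [/\ forall i, 0 <= c i, \sum_i c i = 1, forall i, A (p i)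
      & x = \sum_i c i *: p i]].

Definition aff_hull (N : nat) (A : set 'rV[R]_N) : set 'rV[R]_N :=
  [set x | exists (k : nat) (c : 'I_k -> R) (p : 'I_k -> 'rV[R]_N),
    [/\ \sum_i c i = 1, forall i, A (p i) & x = \sum_i c i *: p i]].

(* n-dimensional Lebesgue measure, as the n-fold product of the one-dimensional
   one; [(m1 \x m2) A] is defined as the integral over [x] of [m2] of the
   x-section of [A]. *)
Fixpoint lebesgue_volume (n : nat) : set (n.-tuple R) -> \bar R :=
  match n with
  | 0 => fun A => \d_[tuple] A
  | m.+1 => fun A =>
      (\int[@lebesgue_measure R]_x
         lebesgue_volume [set t : m.-tuple R | A [tuple of x :: t]])%E
  end.

Definition int_points (N : nat) : set 'rV[R]_N :=
  [set v | forall j, v 0 j \is a Num.int].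

(* [u |-> b + u *m B] identifies R^m with aff(P) and Z^m with the lattice of
   integer points of aff(P). *)
Definition lattice_chart (N : nat) (P : set 'rV[R]_N)
    (m : nat) (b : 'rV[R]_N) (B : 'M[R]_(m, N)) : Prop :=
  [/\ row_free B,
      aff_hull P = [set b + u *m B | u in [set: 'rV[R]_m]]
    & aff_hull P `&` @int_points N = [set b + u *m B | u in @int_points m]].

Definition chart_volume (N : nat) (P : set 'rV[R]_N)
    (m : nat) (b : 'rV[R]_N) (B : 'M[R]_(m, N)) : \bar R :=
  lebesgue_volume [set t : m.-tuple R | P (b + (\row_i tnth t i) *m B)].

(* Volume in aff(P), normalised so that a unit cell of the lattice of integer
   points of aff(P) has volume 1. Lattice charts differ by an integral
   unimodular change of coordinates and an integral translation, so all of them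
   give the same value; the default 0 is used only when aff(P) has no lattice
   chart. *)
Definition normalised_volume (N : nat) (P : set 'rV[R]_N) : \bar R :=
  xget 0%E [set v | exists m (b : 'rV[R]_N) (B : 'M[R]_(m, N)),
    lattice_chart P b B /\ v = chart_volume P b B].

Definition base_polytope (n : nat) (M : matroid 'I_n) : set 'rV[R]_n :=
  conv_hull [set x | exists2 B : {set 'I_n}, B \in bases M
                     & x = \sum_(i in B) delta_mx 0 i].

End Volume.

Arguments base_polytope R {n} M.

(* Main.v *)
(** A point [x] of the cube with coordinate sum [d+1] lies in the base polytope
    iff [f A = rank A - x(A)] is nonnegative on every cyclic flat [A] (Edmonds,
    and the fact that neither closure nor passing to the union of circuits
    increases [f]). If [V] is the set of cyclic flats with [f < 0], Moebius
    inversion gives that the [mu F] of the chains [F] avoiding [V] add up to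
    [\sum_H (-1)^#|H|] over the chains [H] of [V]. As [f] is submodular, meeting
    with a minimiser of [f] maps [V] to itself, so this sum is [0] unless [V] is
    empty: the indicator of the base polytope is the [mu]-weighted sum of the
    indicators of the polytopes given by the inequalities of a single chain.

    In any lattice chart the volume is the limit of [N_k / k^n], where [N_k] is
    the number of points of [k^-1 Z^(n+1)] in the polytope; hence it does not
    depend on the chart, and it suffices to count. For a chain, order the ground
    set so that its members are initial segments; an integer point [y] of the
    dilated polytope is then encoded by its partial sums modulo [k], a word in
    [0..k-1], and [k]-multiples in the partial sums are counted by the descents
    of that word. Up to [O(k^(n-1))] words with repeated letters the count is
    [delta_le / n!] times the falling factorial [(k-1)^_n]. *)
From HB Require Import structures.
Require Import Defs.
From mathcomp Require Import all_boot all_order all_algebra.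
From mathcomp Require Import all_fingroup zify ring lra.

Set Implicit Arguments.
Unset Strict Implicit.
Unset Printing Implicit Defensive.

(** * Rank, closure and cyclic flats *)

(** Closure keeps the rank and adds nonnegative coordinates to [x(A)], so it cannot raise [f]. The
    points of [A] on no circuit inside [A] are coloops of the restriction: dropping them lowers the
    rank by their number and [x(A)] by no more, as coordinates are at most 1.

    Connectedness enters twice. It makes the empty set and the ground set cyclic flats, so that
    every chain of violated flats extends to an anchored chain. It also gives, for any two elements,
    two bases that differ by exchanging them, so that the affine hull is the whole hyperplane of
    coordinate sum [d+1].

    The number of points of the base polytope is an exact signed sum over chains for each [k]; the
    approximations are grid against volume and generic words against all words. Partial sums modulo
    [k] cannot tell a coordinate [k] from a coordinate 0, but both make two consecutive letters
    equal, so the ambiguity affects non-generic words only and costs a factor [2^(n+1)] in the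
    error. The volume error is a constant over [k], uniform in the polyhedron, because the induction
    on the dimension applies it to slices that change with [k]. *)

Section MatroidTheory.

Variables (E : finType) (M : matroid E).
Implicit Types (A B C F G I J X Y : {set E}) (x y : E).

Lemma indepP A : reflect (exists2 B, B \in bases M & A \subset B) (indep M A).
Proof. by apply: (iffP exists_inP). Qed.

Lemma indepS A B : A \subset B -> indep M B -> indep M A.
Proof.
by move=> sAB /indepP[D DM sBD]; apply/indepP; exists D => //; exact: subset_trans sBD.
Qed.

Lemma indep0 : indep M set0.
Proof.
have /set0Pn[B BM] := bases_neq0 M.
by apply/indepP; exists B; rewrite ?sub0set.
Qed.

Lemma card_swap A x y : x \in A -> y \notin A -> #|y |: (A :\ x)| = #|A|.
Proof.
move=> xA yA; rewrite cardsU1 in_setD1 negb_and negbK yA orbT add1n.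
by rewrite [in RHS](cardsD1 x) xA.
Qed.

(** Each exchange keeps [#|A|] and removes a point of [A :\: B], until [A] lies inside [B]. *)
Lemma leq_card_bases A B : A \in bases M -> B \in bases M -> #|A| <= #|B|.
Proof.
have [m] := ubnP #|A :\: B|; elim: m A => // m IH A ltm AM BM.
have [/eqP|/set0Pn[x xAB]] := eqVneq (A :\: B) set0.
  by rewrite setD_eq0 => /subset_leq_card.
have [y /setDP[yB yA] AM'] := bases_exchange AM BM xAB.
have /setDP[xA xB] := xAB.
rewrite -(card_swap xA yA); apply: IH => //.
rewrite -ltnS; apply: leq_trans ltm; rewrite ltnS; apply: proper_card.
apply/properP; split; last by exists x => //; rewrite !inE eqxx xA (negbTE xB) /= orbF;
  apply: contraNneq yA => <-.
apply/subsetP => z; rewrite !inE => /andP[zB /orP[/eqP zy|/andP[_ ->]]]; last by rewrite zB.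
by rewrite zy yB in zB.
Qed.

Lemma card_bases A B : A \in bases M -> B \in bases M -> #|A| = #|B|.
Proof. by move=> AM BM; apply/eqP; rewrite eqn_leq !leq_card_bases. Qed.

(** Let [B] be a base containing [J]. Among the bases containing [I], one that meets [B] most lies
    in [I :|: B], since an exchange would otherwise enlarge the intersection. If it missed
    [J :\: I], then [A :\: I] would lie in the smaller set [B :\: J]. *)
Lemma indep_augment I J : indep M I -> indep M J -> #|I| < #|J| ->
  exists2 x, x \in J :\: I & indep M (x |: I).
Proof.
move=> /indepP[A0 A0M IA0] /indepP[B BM JB] ltIJ.
pose P A := (A \in bases M) && (I \subset A).
have PA0 : P A0 by rewrite /P A0M.
case: (@arg_maxnP _ A0 P (fun A => #|A :&: B|) PA0) => A /andP[AM IA] maxA.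
have sAIB : A \subset I :|: B.
  apply/subsetP => x xA; rewrite inE; apply/orP.
  case xI: (x \in I); first by left.
  case xB: (x \in B); first by right.
  have xAB : x \in A :\: B by rewrite inE xB.
  have [y /setDP[yB yA] AM'] := bases_exchange AM BM xAB.
  have : P (y |: (A :\ x)).
    rewrite /P AM' /=; apply/subsetP => z zI; rewrite !inE (subsetP IA _ zI) andbT.
    by apply/orP; right; apply: contraFneq xI => <-.
  move=> /maxA /=; rewrite leqNgt => /negP[]; apply: proper_card.
  apply/properP; split; last by exists y; rewrite !inE ?eqxx ?yB // (negbTE yA).
  apply/subsetP => z; rewrite !inE => /andP[zA zB]; rewrite zA zB !andbT.
  by apply/orP; right; apply: contraFneq xB => <-.
have [x] : exists x, x \in A :&: (J :\: I).
  apply/set0Pn; apply: contraTneq ltIJ => dis; rewrite -leqNgt.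
  have sD : A :\: I \subset B :\: J.
    apply/subsetP => z /setDP[zA zI]; rewrite !inE.
    have := subsetP sAIB _ zA; rewrite !inE (negbTE zI) /= => ->; rewrite andbT.
    by apply/negP => zJ; have := in_set0 z; rewrite -dis !inE zA zJ zI.
  have := subset_leq_card sD; rewrite !cardsD (setIidPr IA) (setIidPr JB).
  rewrite (card_bases AM BM); have := subset_leq_card JB; lia.
rewrite !inE => /and3P[xA xI xJ]; exists x; first by rewrite !inE xI.
by apply/indepP; exists A => //; rewrite subUset sub1set xA.
Qed.

Lemma rank_ge I A : I \subset A -> indep M I -> #|I| <= rank M A.
Proof. by move=> IA iI; rewrite /rank (leq_bigmax_cond (F := fun I => #|I|)) // IA. Qed.

Lemma rank_basis A : exists J, [/\ J \subset A, indep M J & #|J| = rank M A].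
Proof.
have [|J /andP[JA iJ] eJ] := @eq_bigmax_cond _ [pred I : {set E} | (I \subset A) && indep M I] (fun I => #|I|).
  by apply/card_gt0P; exists set0; rewrite inE sub0set indep0.
by exists J; split=> //; rewrite -eJ; apply: eq_bigl => I; rewrite inE.
Qed.

Lemma rank_extend I A : I \subset A -> indep M I ->
  exists J, [/\ I \subset J, J \subset A, indep M J & #|J| = rank M A].
Proof.
have [m] := ubnP (rank M A - #|I|); elim: m I => // m IH I ltm IA iI.
have [J [JA iJ cJ]] := rank_basis A.
have := rank_ge IA iI; rewrite leq_eqVlt => /orP[/eqP eI|ltI]; first by exists I.
have [|x /setDP[xJ xI] iI'] := @indep_augment I J iI iJ; first by rewrite cJ.
have [||//|K [sK KA iK cK]] := IH (x |: I).
- by rewrite cardsU1 xI; lia.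
- by rewrite subUset sub1set (subsetP JA).
exists K; split=> //; apply: subset_trans sK; exact: subsetUr.
Qed.

Lemma rank_le_card A : rank M A <= #|A|.
Proof. by have [J [JA _ <-]] := rank_basis A; exact: subset_leq_card. Qed.

Lemma rankS A B : A \subset B -> rank M A <= rank M B.
Proof.
by move=> AB; have [J [JA iJ <-]] := rank_basis A; apply: rank_ge => //; exact: subset_trans AB.
Qed.

Lemma rank0 : rank M set0 = 0.
Proof. by apply/eqP; rewrite -leqn0 -(@cards0 E) rank_le_card. Qed.

Lemma rank_indep I : indep M I -> rank M I = #|I|.
Proof. by move=> iI; apply/eqP; rewrite eqn_leq rank_le_card rank_ge. Qed.

Lemma card_rank_indep I : #|I| <= rank M I -> indep M I.
Proof.
have [J [JI iJ <-]] := rank_basis I => leIJ.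
by have /eqP <- : J == I by rewrite eqEcard JI.
Qed.

(** A basis of the intersection extends to a basis [J] of the union; the traces of [J] on [A] and
    [B] are independent and share at least the basis started from. *)
Lemma rank_submod A B : rank M (A :|: B) + rank M (A :&: B) <= rank M A + rank M B.
Proof.
have [I [sI iI <-]] := rank_basis (A :&: B).
have sIU : I \subset A :|: B by apply: subset_trans sI _; rewrite subIset ?subsetUl.
have [J [IJ JU iJ <-]] := rank_extend sIU iI.
have leA : #|J :&: A| <= rank M A by rewrite rank_ge ?subsetIr ?(indepS _ iJ) ?subsetIl.
have leB : #|J :&: B| <= rank M B by rewrite rank_ge ?subsetIr ?(indepS _ iJ) ?subsetIl.
apply: leq_trans (leq_add leA leB); rewrite -(cardsUI (J :&: A)) -setIUr (setIidPl JU) leq_add2l.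
apply: subset_leq_card; rewrite setIACA setIid subsetI IJ.
exact: sI.
Qed.

Lemma rank_diff A B : A \subset B -> rank M B - rank M A <= #|B| - #|A|.
Proof.
move=> AB; have := rank_submod A (B :\: A).
have -> : A :|: (B :\: A) = B.
  by apply/setP => z; rewrite !inE; case zA: (z \in A) => //=; rewrite (subsetP AB).
have := rank_le_card (B :\: A); rewrite cardsDS // => le1 le2.
lia.
Qed.

Lemma rankU1_le A B x : A \subset B ->
  rank M (x |: B) + rank M A <= rank M (x |: A) + rank M B.
Proof.
move=> AB; apply: leq_trans (leq_trans (rank_submod (x |: A) B) _) => //.
rewrite -setUA (setUidPr AB) leq_add2l rankS // subsetI AB andbT subsetUr //.
Qed.

Lemma flatP F : reflect (forall x, x \notin F -> rank M F < rank M (x |: F)) (flat M F).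
Proof. exact: 'forall_implyP. Qed.

Lemma flatI F G : flat M F -> flat M G -> flat M (F :&: G).
Proof.
move=> /flatP fF /flatP fG; apply/flatP => x; rewrite inE negb_and => /orP[/fF|/fG].
  by have := rankU1_le x (subsetIl F G); lia.
by have := rankU1_le x (subsetIr F G); lia.
Qed.

Definition span A : {set E} := [set x | rank M (x |: A) == rank M A].

Lemma sub_span A : A \subset span A.
Proof. by apply/subsetP => x xA; rewrite inE (setUidPr _) ?sub1set. Qed.

Lemma rank_sub_span A B : A \subset B -> B \subset span A -> rank M B = rank M A.
Proof.
move=> AB BA; apply/eqP; rewrite eqn_leq (rankS AB) andbT leqNgt; apply/negP => lt.
have [I [IA iI cI]] := rank_basis A; have [J [JB iJ cJ]] := rank_basis B.
have [|x /setDP[xJ xI] ixI] := indep_augment iI iJ; first by rewrite cI cJ.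
have := subsetP BA _ (subsetP JB _ xJ); rewrite inE => /eqP eqr.
have : #|x |: I| <= rank M (x |: A) by rewrite rank_ge ?setUS.
by rewrite eqr cardsU1 xI cI; lia.
Qed.

Lemma rank_span A : rank M (span A) = rank M A.
Proof. by rewrite (rank_sub_span (sub_span A)). Qed.

Lemma span_flat A : flat M (span A).
Proof.
apply/flatP => x; rewrite inE rank_span => xA.
have : rank M A <= rank M (x |: A) by rewrite rankS ?subsetUr.
have : rank M (x |: A) <= rank M (x |: span A) by rewrite rankS ?setUS ?sub_span.
by move: xA; lia.
Qed.

Lemma dep_circuit A : ~~ indep M A -> exists2 C, circuit M C & C \subset A.
Proof. by move=> /(minset_exists (P := fun A => ~~ indep M A))[C mC CA]; exists C. Qed.

Lemma circuit_dep C : circuit M C -> ~~ indep M C.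
Proof. by move/minsetp. Qed.

Lemma circuit_proper C A : circuit M C -> A \proper C -> indep M A.
Proof.
move=> /minsetP[_ minC] /andP[AC nCA]; apply: contraR nCA => nA.
by rewrite (minC A nA AC).
Qed.

(** What remains of [A] once the coloops of the restriction of the matroid to [A] are deleted. *)
Definition cyc A : {set E} := \bigcup_(C : {set E} | circuit M C && (C \subset A)) C.

Lemma cycP A x : reflect (exists C, [/\ circuit M C, C \subset A & x \in C]) (x \in cyc A).
Proof.
apply: (iffP bigcupP) => [[C /andP[mC CA] xC]|[C [mC CA xC]]]; exists C => //.
by rewrite mC.
Qed.

Lemma cyc_sub A : cyc A \subset A.
Proof. by apply/bigcupsP => C /andP[]. Qed.

Lemma circuit_cyc A C : circuit M C -> C \subset A -> C \subset cyc A.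
Proof. by move=> mC CA; apply: bigcup_sup; rewrite mC. Qed.

Lemma cycS A B : A \subset B -> cyc A \subset cyc B.
Proof.
by move=> AB; apply/bigcupsP => C /andP[mC CA]; apply: circuit_cyc => //; exact: subset_trans AB.
Qed.

Lemma cyc_cyc A : cyc (cyc A) = cyc A.
Proof.
apply/eqP; rewrite eqEsubset cyc_sub /=.
by apply/bigcupsP => C /andP[mC CA]; do 2!apply: circuit_cyc => //.
Qed.

(** A basis of [cyc A] stays independent when all of [A :\: cyc A] is added: a circuit in the union
    would lie in [cyc A], hence in the basis. *)
Lemma rank_cyc A : rank M (cyc A) + #|A :\: cyc A| <= rank M A.
Proof.
have [I [IA iI <-]] := rank_basis (cyc A).
have disj : I :&: (A :\: cyc A) = set0.
  by apply/setP => x; rewrite !inE; apply/negP => /and3P[/(subsetP IA) ->].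
have <- : #|I :|: (A :\: cyc A)| = #|I| + #|A :\: cyc A| by rewrite cardsU disj cards0 subn0.
have sU : I :|: (A :\: cyc A) \subset A by rewrite subUset subsetDl (subset_trans IA (cyc_sub A)).
apply: rank_ge => //; apply: contraT => /dep_circuit[C mC CU].
have CA := circuit_cyc mC (subset_trans CU sU).
move: (circuit_dep mC) => /negP[]; apply: indepS iI; apply/subsetP => x xC.
by have := subsetP CU _ xC; rewrite !inE (subsetP CA _ xC) /= orbF.
Qed.

(** If [y] does not raise the rank, adding it to a basis of [X] creates a circuit, and this circuit
    passes through [y]. *)
Lemma rankU1_cyc X y : y \notin X -> rank M (y |: X) <= rank M X -> y \in cyc (y |: X).
Proof.
move=> yX le; have [I [IX iI cI]] := rank_basis X.
have : ~~ indep M (y |: I).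
  apply/negP => /(rank_ge (setUS _ IX)); rewrite cardsU1 (contra _ yX) ?cI; first lia.
  exact: (subsetP IX).
case/dep_circuit => C mC CI; apply/cycP; exists C; split=> //.
  by apply: subset_trans CI _; apply: setUS.
apply/negPn/negP => yC; case/negP: (circuit_dep mC); apply: indepS iI.
apply/subsetP => x xC; have := subsetP CI _ xC; rewrite !inE => /orP[/eqP xy|//].
by rewrite -xy xC in yC.
Qed.

(** A point outside [F] raises the rank of [cyc F] by submodularity. A point of [F] that did not
    raise it would lie on a circuit inside [F], hence already in [cyc F]. *)
Lemma cyc_flat F : flat M F -> flat M (cyc F).
Proof.
move=> /flatP fF; apply/flatP => y yG.
have [yF|yF] := boolP (y \in F); last first.
  by have := rankU1_le y (cyc_sub F); have := fF _ yF; lia.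
rewrite ltnNge; apply/negP => /(rankU1_cyc yG) yc; case/negP: yG.
by apply: (subsetP (cycS _)) yc; rewrite subUset sub1set yF cyc_sub.
Qed.

Lemma cyclic_flatE F : cyclic_flat M F = flat M F && (cyc F == F).
Proof. by rewrite /cyclic_flat eq_sym. Qed.

(** Meet in the lattice of cyclic flats: an intersection of cyclic flats is a flat but may have
    coloops, which [cyc] removes. *)
Lemma cyclic_flat_meet F G : cyclic_flat M F -> cyclic_flat M G ->
  cyclic_flat M (cyc (F :&: G)).
Proof.
rewrite !cyclic_flatE => /andP[fF _] /andP[fG _].
by rewrite cyc_cyc eqxx andbT cyc_flat ?flatI.
Qed.

(** A point added by the closure lies on a circuit inside [span X], so closing a union of circuits
    leaves a union of circuits. On [F :|: G] this gives the join in the lattice of cyclic flats. *)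
Lemma cyclic_flat_span X : cyc X = X -> cyclic_flat M (span X).
Proof.
move=> cX; rewrite cyclic_flatE span_flat eqEsubset cyc_sub /=.
apply/subsetP => y; have [yX _|yX] := boolP (y \in X).
  by rewrite -cX in yX; apply: (subsetP (cycS (sub_span X))) yX.
move=> yS; have : y \in cyc (y |: X).
  by apply: rankU1_cyc => //; move: yS; rewrite inE => /eqP ->.
by apply: (subsetP (cycS _)); rewrite subUset sub1set yS sub_span.
Qed.

Lemma cycU X Y : cyc X = X -> cyc Y = Y -> cyc (X :|: Y) = X :|: Y.
Proof.
move=> cX cY; apply/eqP; rewrite eqEsubset cyc_sub subUset.
by rewrite -{1}cX -{2}cY !cycS ?subsetUl ?subsetUr.
Qed.

Lemma cyclic_flat_join F G : cyclic_flat M F -> cyclic_flat M G ->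
  cyclic_flat M (span (F :|: G)).
Proof.
rewrite !(cyclic_flatE F, cyclic_flatE G) => /andP[_ /eqP cF] /andP[_ /eqP cG].
by apply: cyclic_flat_span; exact: cycU.
Qed.

Lemma cyclic_flat_span_cyc X : cyclic_flat M (cyc (span X)).
Proof. by rewrite cyclic_flatE cyc_cyc eqxx cyc_flat ?span_flat. Qed.

Hypothesis conM : matroid_connected M.
Hypothesis card_E : 1 < #|E|.

Lemma exists_other x : exists y, x != y.
Proof.
have /card_gt0P[y] : 0 < #|predC1 x| by rewrite cardC1; lia.
by rewrite inE eq_sym => xy; exists y.
Qed.

Lemma connected_indep1 x : indep M [set x].
Proof.
have [y xy] := exists_other x; have [C [mC xC yC]] := conM xy.
apply: (circuit_proper mC); apply/properP; rewrite sub1set; split=> //.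
by exists y => //; rewrite inE eq_sym.
Qed.

Lemma cyclic_flat0 : cyclic_flat M set0.
Proof.
rewrite cyclic_flatE -subset0 cyc_sub andbT; apply/flatP => x _.
by rewrite rank0 setU0 rank_indep ?cards1 ?connected_indep1.
Qed.

Lemma cyclic_flatT : cyclic_flat M setT.
Proof.
rewrite cyclic_flatE; apply/andP; split; first by apply/flatP => x; rewrite inE.
rewrite eqEsubset subsetT /=; apply/subsetP => x _; apply/cycP.
have [y xy] := exists_other x; have [C [mC xC yC]] := conM xy.
by exists C; rewrite subsetT.
Qed.

(** A circuit [C] through [x] and [y] supplies both bases: [C :\ y] extends to [B], and [C :\ x]
    extends within [B :|: C] to a base that can only be [y |: (B :\ x)]. The difference of the two
    vertices is [e_x - e_y], a direction of the affine hull. *)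
Lemma connected_swap x y : x != y ->
  exists B, [/\ B \in bases M, x \in B, y \notin B & y |: (B :\ x) \in bases M].
Proof.
move=> xy; have [C [mC xC yC]] := conM xy.
have yC' : y \notin C :\ y by rewrite !inE eqxx.
have iCy : indep M (C :\ y) by apply: circuit_proper mC _; rewrite properD1.
have iCx : indep M (C :\ x) by apply: circuit_proper mC _; rewrite properD1.
case/indepP: iCy => B BM CB.
have yB : y \notin B.
  apply/negP => yB; case/negP: (circuit_dep mC); apply/indepP; exists B => //.
  by rewrite -(setD1K yC) subUset sub1set yB.
have xB : x \in B by rewrite (subsetP CB) // !inE xy.
exists B; split=> //.
have iB : indep M B by apply/indepP; exists B.
have [J [CJ JB iJ cJ]] := rank_extend (subset_trans (subD1set C x) (subsetUr B C)) iCx.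
have cJB : #|J| = #|B|.
  case/indepP: (iJ) => B' B'M JB'; apply/eqP; rewrite eqn_leq cJ.
  rewrite (rank_ge (subsetUl B C) iB) andbT -cJ -(card_bases B'M BM).
  exact: subset_leq_card.
have xJ : x \notin J.
  apply/negP => xJ; case/negP: (circuit_dep mC); apply: indepS iJ.
  by rewrite -(setD1K xC) subUset sub1set xJ.
have sJ : J \subset y |: (B :\ x).
  apply/subsetP => z zJ; rewrite !inE; have [//|zy] := eqVneq z y.
  rewrite (contraTneq _ zJ) => [/=|-> //]; have := subsetP JB _ zJ; rewrite inE => /orP[//|zC].
  by rewrite (subsetP CB) // !inE zy.
have /eqP eJ : J == y |: (B :\ x) by rewrite eqEcard sJ card_swap //= cJB.
case/indepP: iJ => B' B'M; rewrite eJ => sB.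
suff /eqP -> : y |: (B :\ x) == B' by [].
by rewrite eqEcard sB card_swap //= (card_bases BM B'M).
Qed.

End MatroidTheory.

(** * Chains of violated cyclic flats *)

Import Order.TTheory GRing.Theory Num.Theory.
Local Open Scope ring_scope.

(** * Sign-reversing involutions on subsets *)

Definition toggle (T : finType) (x : T) (H : {set T}) : {set T} :=
  if x \in H then H :\ x else x |: H.

Lemma toggleK (T : finType) (x : T) : involutive (toggle x).
Proof.
move=> H; rewrite /toggle; have [xH|xH] := boolP (x \in H); first by rewrite setD11 setD1K.
by rewrite setU11 setU1K.
Qed.

Lemma sign_toggle (T : finType) (x : T) (H : {set T}) :
  (-1) ^+ #|toggle x H| = - (-1) ^+ #|H| :> int.
Proof.
rewrite /toggle; case: ifPn => xH; last by rewrite cardsU1 xH exprS mulN1r.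
by rewrite [in RHS](cardsD1 x) xH exprS mulN1r opprK.
Qed.

(** The pivot [m H] may vary with [H], provided that toggling it does not change the pivot; toggling
    is then an involution that flips every sign. *)
Lemma sum_sign_toggle (T : finType) (P : pred {set T}) (m : {set T} -> T) :
    (forall H, P H -> P (toggle (m H) H)) ->
    (forall H, P H -> m (toggle (m H) H) = m H) ->
  \sum_(H : {set T} | P H) (-1) ^+ #|H| = 0 :> int.
Proof.
move=> PP mm; set S := LHS.
have SN : S = - S.
  rewrite -[in RHS]sumrN /S (reindex_onto (fun H => toggle (m H) H) (fun H => toggle (m H) H)) /=.
    rewrite (eq_bigl P) => [|H].
      by apply: eq_bigr => H _; rewrite sign_toggle.
    apply/andP/idP => [[PH /eqP eH]|PH]; first by rewrite -eH; exact: PP.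
    by rewrite PP // mm // toggleK.
  by move=> H PH; rewrite mm // toggleK.
lia.
Qed.

Lemma sum_sign_subset (T : finType) (W : {set T}) :
  \sum_(H : {set T} | H \subset W) (-1) ^+ #|H| = (W == set0)%:R :> int.
Proof.
have [->|/set0Pn[x xW]] := eqVneq.
  rewrite (eq_bigl (pred1 set0)) => [|H]; last by rewrite subset0.
  by rewrite big_pred1_eq cards0.
apply: (@sum_sign_toggle _ _ (fun=> x)) => // H HW.
by rewrite /toggle; case: ifP => _; [rewrite (subset_trans (subD1set _ _)) | rewrite subUset sub1set xW].
Qed.

(** * Moebius inversion over anchored chains *)

Section ChainSums.

Variables (E : finType) (M : matroid E).
Hypotheses (conM : matroid_connected M) (card_E : (1 < #|E|)%N).

Lemma hat_le_refl : reflexive (@hat_le E M).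
Proof. by case=> //= F; rewrite /chain_refines. Qed.

Lemma hat_le_anti : antisymmetric (@hat_le E M).
Proof.
case=> [F|] [G|] //=; rewrite /chain_refines => /andP[GF FG].
by congr Some; apply/val_inj/eqP; rewrite eqEsubset; apply/andP.
Qed.

Lemma hat_le_trans : transitive (@hat_le E M).
Proof.
by case=> [F|] [G|] [K|] //=; rewrite /chain_refines => GF FK; exact: subset_trans GF.
Qed.

(** The recursion of the Moebius function on the interval from the new bottom to [F]: the bottom
    contributes 1, and the remaining terms are the [- chain_mu G] of the refinements [G] of [F]. *)
Lemma chain_mu_sum (F : anchored_chain M) :
  \sum_(G : anchored_chain M | chain_refines G F) chain_mu G = 1.
Proof.
have := mobiusE hat_le_refl hat_le_anti hat_le_trans None (Some F).
move=> /(congr1 -%R); rewrite /= opprK => eF.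
have rF : chain_refines F F by rewrite /chain_refines.
rewrite (bigD1 F) //= {1}/chain_mu eF.
rewrite (bigD1 None) //= (_ : mobius _ None None = 1); last first.
  by rewrite (mobiusE hat_le_refl hat_le_anti hat_le_trans) eqxx.
rewrite -addrA (reindex_onto (@Some (anchored_chain M)) (odflt F)) /=; last by case.
under [X in _ + (X + _)]eq_bigl => G do rewrite eqxx !andbT.
by rewrite -big_split big1 ?addr0 // => G _; rewrite /= /chain_mu subrr.
Qed.

Definition is_chain (H : {set {set E}}) : bool :=
  [forall A in H, forall B in H, (A \subset B) || (B \subset A)].

Lemma is_chainP (H : {set {set E}}) : reflect (forall A B, A \in H -> B \in H -> (A \subset B) || (B \subset A))
  (is_chain H).
Proof.
apply: (iffP forall_inP) => [cH A B AH|cH A AH]; first by move/(forall_inP (cH A AH)).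
by apply/forall_inP => B; exact: cH.
Qed.

Lemma anchored_chainP (F : anchored_chain M) :
  [/\ set0 \in chain_set F, setT \in chain_set F, {in chain_set F, forall A, cyclic_flat M A}
    & is_chain F].
Proof. by have /and4P[? ? /forall_inP ? ?] := chain_setP F. Qed.

(** Inclusion-exclusion over the subsets [H] of [chain_set F :&: V], with the two sums exchanged.
    The chains [F] containing a chain [H] are the refinements of [H] completed by the empty set and
    the ground set, and their weights add up to 1; an [H] that is no chain lies in no [F]. *)
Lemma sum_chain_mu_disjoint (V : {set {set E}}) :
    {in V, forall A, cyclic_flat M A} -> set0 \notin V -> setT \notin V ->
  \sum_(F : anchored_chain M | [disjoint chain_set F & V]) chain_mu F =
  \sum_(H : {set {set E}} | is_chain H && (H \subset V)) (-1) ^+ #|H|.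
Proof.
move=> cV V0 VT.
transitivity (\sum_(F : anchored_chain M) \sum_(H : {set {set E}})
    if (H \subset chain_set F :&: V) then (-1) ^+ #|H| * chain_mu F else 0).
  rewrite big_mkcond; apply: eq_bigr => F _; rewrite -big_mkcond -mulr_suml sum_sign_subset.
  by rewrite setI_eq0; case: ifP; rewrite ?mul1r ?mul0r.
rewrite exchange_big [RHS]big_mkcond; apply: eq_bigr => H _ /=.
under eq_bigr do rewrite subsetI.
have [HV|HV] := boolP (H \subset V); last first.
  by rewrite andbF big1 // => F _; rewrite andbF.
under eq_bigr do rewrite andbT.
rewrite -big_mkcond -mulr_sumr andbT; case: (boolP (is_chain H)) => [cH|ncH]; last first.
  rewrite big_pred0 ?mulr0 // => F; apply: contraNF ncH => HF.
  have [_ _ _ /is_chainP cF] := anchored_chainP F.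
  by apply/is_chainP => A B AH BH; apply: cF; exact: (subsetP HF).
have cF : is_anchored_chain M (set0 |: (setT |: H)).
  apply/and4P; split; rewrite ?inE ?eqxx ?orbT //.
    apply/forall_inP => A; rewrite !inE => /or3P[/eqP->|/eqP->|AH].
    - exact: cyclic_flat0. - exact: cyclic_flatT.
    exact: cV (subsetP HV _ AH).
  apply/is_chainP => A B; rewrite !inE.
  move=> /or3P[/eqP->|/eqP->|AH]; rewrite ?sub0set ?subsetT ?orbT //.
  move=> /or3P[/eqP->|/eqP->|BH]; rewrite ?sub0set ?subsetT ?orbT //.
  exact: (is_chainP _ cH).
rewrite -[RHS]mulr1 -(chain_mu_sum (AnchoredChain cF)); congr (_ * _).
apply: eq_bigl => F; rewrite /chain_refines /= !subUset !sub1set.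
by have [-> -> _ _] := anchored_chainP F.
Qed.

Section Violated.

Variable f : {set E} -> int.
Hypothesis f_submod : forall A B, f (A :|: B) + f (A :&: B) <= f A + f B.
Hypothesis f_span : forall X, f (span M X) <= f X.
Hypothesis f_cyc : forall X, f (cyc M X) <= f X.

Let V : {set {set E}} := [set A | cyclic_flat M A && (f A < 0)].

(* Meeting with the minimiser [A0] of [f] stays inside [V] by submodularity,
   so the order complex of [V] is a cone up to homotopy. *)
Lemma sum_sign_chain_violated : V != set0 ->
  \sum_(H : {set {set E}} | is_chain H && (H \subset V)) (-1) ^+ #|H| = 0 :> int.
Proof.
case/set0Pn => A1; rewrite inE => /andP[cA1 fA1].
pose A0 := [arg min_(A < A1 | cyclic_flat M A) f A]%O.
have [cA0 minA0] : cyclic_flat M A0 /\ forall A, cyclic_flat M A -> f A0 <= f A.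
  by rewrite /A0; case: arg_minP.
have fA0 : f A0 < 0 by apply: le_lt_trans fA1; exact: minA0.
have A0V : A0 \in V by rewrite inE cA0.
(* Submodularity gives [f (A0 :&: B) <= f B + (f A0 - f (A0 :|: B))]. The bracket is at most 0,
   since closing the union does not raise [f] and gives a cyclic flat, where [f] is at least
   [f A0]. *)
have meetV B : B \in V -> cyc M (A0 :&: B) \in V.
  rewrite !inE => /andP[cB fB]; rewrite cyclic_flat_meet //=.
  apply: le_lt_trans (f_cyc _) _.
  have := f_submod A0 B; have := f_span (A0 :|: B).
  have := minA0 _ (cyclic_flat_join cA0 cB); lia.
(* The pivot is the meet of [A0] with the smallest member of [H] not contained in [A0], or [A0]
   itself if there is none. As it lies in [A0], toggling it leaves [up H], and with it the pivot,
   unchanged. *)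
pose up (H : {set {set E}}) := [set B in H | ~~ (B \subset A0)].
pose m (H : {set {set E}}) := cyc M (A0 :&: \bigcap_(B in up H) B).
have m_sub H : m H \subset A0 by apply: subset_trans (cyc_sub _ _) (subsetIl _ _).
have m_subU H B : B \in up H -> m H \subset B.
  move=> BH; apply: subset_trans (cyc_sub _ _) _; apply: subset_trans (subsetIr _ _) _.
  exact: bigcap_inf.
have m_toggle H : m (toggle (m H) H) = m H.
  rewrite {1}/m; suff -> : up (toggle (m H) H) = up H by [].
  apply/setP => B; rewrite !inE; apply: andb_id2r => nB.
  have BmH : B != m H by apply: contraNneq nB => ->.
  by rewrite /toggle; case: ifP => _; rewrite !inE (negbTE BmH).
apply: (sum_sign_toggle (m := m)) => [H /andP[/is_chainP cH HV]|H _]; last exact: m_toggle.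
have mV : m H \in V.
  have [U0|/set0Pn[B0 B0U]] := eqVneq (up H) set0.
    rewrite /m U0 big_set0 setIT; move: cA0; rewrite cyclic_flatE => /andP[_ /eqP ->].
    exact: A0V.
  case: (@arg_minnP _ B0 (mem (up H)) (fun B => #|B|) B0U) => b bU minb.
  have bH : b \in H by move: bU; rewrite !inE => /andP[].
  rewrite /m (_ : \bigcap_(B in up H) B = b) ?meetV ?(subsetP HV) //.
  apply/eqP; rewrite eqEsubset bigcap_inf //=; apply/bigcapsP => B BU.
  have BH : B \in H by move: BU; rewrite inE => /andP[].
  have /orP[//|Bb] := cH _ _ bH BH.
  by suff /eqP -> : B == b by []; rewrite eqEcard Bb; exact: minb.
(* A member inside [A0] lies below every member not contained in [A0], hence below their
   intersection with [A0]; being a union of circuits, it then lies in the pivot. *)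
have m_comp B : B \in H -> (B \subset m H) || (m H \subset B).
  move=> BH; have [BA0|nB] := boolP (B \subset A0); last first.
    by rewrite m_subU ?orbT // inE BH.
  have := subsetP HV _ BH; rewrite inE cyclic_flatE => /andP[/andP[_ /eqP <-] _].
  apply/orP; left; apply: cycS; rewrite subsetI BA0; apply/bigcapsP => C; rewrite inE.
  move=> /andP[CH nC]; have /orP[//|CB] := cH _ _ BH CH.
  by rewrite (subset_trans CB BA0) in nC.
rewrite /toggle; case: ifPn => mH.
  rewrite (subset_trans (subD1set _ _) HV) andbT; apply/is_chainP => A B.
  by rewrite !inE => /andP[_ AH] /andP[_ BH]; exact: cH.
rewrite subUset sub1set mV HV !andbT; apply/is_chainP => A B; rewrite !inE.
move=> /orP[/eqP->|AH] /orP[/eqP->|BH]; rewrite ?subxx //; last exact: cH.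
- by rewrite orbC m_comp.
- exact: m_comp.
Qed.

Lemma sum_chain_mu : 0 <= f set0 -> 0 <= f setT ->
  \sum_(F : anchored_chain M | [forall A in chain_set F, 0 <= f A]) chain_mu F =
  [forall (A | cyclic_flat M A), 0 <= f A]%:R.
Proof.
move=> f0 fT.
rewrite (eq_bigl (fun F : anchored_chain M => [disjoint chain_set F & V])) => [|F]; last first.
  have [_ _ cF _] := anchored_chainP F.
  rewrite disjoint_subset; apply/forall_inP/subsetP => [h A AF|h A AF].
    by rewrite !inE negb_and -leNgt h ?orbT.
  by have := h A AF; rewrite !inE cF //= -leNgt.
rewrite sum_chain_mu_disjoint; first last.
- by rewrite inE negb_and -leNgt fT orbT.
- by rewrite inE negb_and -leNgt f0 orbT.
- by move=> A; rewrite inE => /andP[].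
have [V0|Vn0] := eqVneq V set0.
  rewrite V0 (eq_bigl (pred1 set0)) => [|H]; last first.
    by rewrite subset0 /=; case: eqP => [->|]; rewrite ?andbF // andbT;
      apply/is_chainP => A B; rewrite inE.
  rewrite big_pred1_eq cards0 (introT forall_inP) // => A cA.
  by have := in_set0 A; rewrite -V0 inE cA /= ltNge => /negbFE.
rewrite sum_sign_chain_violated //; case: forall_inP => // h.
case/set0Pn: Vn0 => A; rewrite inE => /andP[/h]; lia.
Qed.

End Violated.

End ChainSums.

(** * The rank inequalities of the base polytope *)

Local Open Scope ring_scope.

(** Stated for a monoid law because it serves sums of real numbers and of natural numbers alike. *)
Lemma big_setUI (T : finType) (S : Type) (idx : S) (op : Monoid.com_law idx)
    (A B : {set T}) (x : T -> S) :
  op (\big[op/idx]_(i in A :|: B) x i) (\big[op/idx]_(i in A :&: B) x i) =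
  op (\big[op/idx]_(i in A) x i) (\big[op/idx]_(i in B) x i).
Proof.
rewrite !(big_mkcond (fun i => i \in _)) -!big_split; apply: eq_bigr => i _.
by rewrite !inE; case: (i \in A); case: (i \in B); rewrite /= ?Monoid.mulm1 ?Monoid.mul1m.
Qed.

Section Edmonds.

Variables (R : realFieldType) (E : finType) (M : matroid E).
Implicit Types (x : {ffun E -> R}) (A B S T : {set E}) (i j l : E).

Definition in_rank_polytope x : Prop :=
  [/\ forall i, 0 <= x i, forall A, \sum_(i in A) x i <= (rank M A)%:R
    & \sum_i x i = (rank M setT)%:R].

Definition indicator B : {ffun E -> R} := [ffun i => (i \in B)%:R].

Lemma sum_pred1_set A i : \sum_(l in A) (l == i)%:R = (i \in A)%:R :> R.
Proof.
have [iA|iA] := boolP (i \in A).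
  rewrite (bigD1 i) //= eqxx big1 ?addr0 // => l /andP[_ /negbTE ->] //.
by rewrite big1 // => l lA; case: eqP => // li; rewrite -li lA in iA.
Qed.

Let tight x : {set {set E}} := [set A : {set E} | \sum_(i in A) x i == (rank M A)%:R].
Let zeros x : {set E} := [set i | x i == 0].
Let frac x : {set E} := [set i | 0 < x i < 1].
Let slack x A : R := (rank M A)%:R - \sum_(i in A) x i.
(** Number of inequalities that are strict at [x]; it decreases along the induction that ends at the
    integral points. *)
Let defect x : nat := (#|~: tight x| + #|~: zeros x|)%N.

Lemma rank_polytope_le1 x : in_rank_polytope x -> forall i, x i <= 1.
Proof.
case=> _ xA _ i; have := xA [set i]; rewrite big_set1 => /le_trans; apply.
by rewrite -[1]/(1%:R) ler_nat (leq_trans (rank_le_card _ _)) // cards1.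
Qed.

Lemma tightT x : in_rank_polytope x -> setT \in tight x.
Proof.
by case=> _ _ xT; rewrite inE -xT; apply/eqP; apply: eq_bigl => i; rewrite inE.
Qed.

Lemma tightI x S T : in_rank_polytope x -> S \in tight x -> T \in tight x ->
  S :&: T \in tight x.
Proof.
move=> [_ xA _]; rewrite !inE => /eqP xS /eqP xT.
have := big_setUI +%R S T x; rewrite /= xS xT => e.
have := rank_submod M S T; rewrite -(ler_nat R) !natrD => sub.
have := xA (S :|: T); have := xA (S :&: T) => le1 le2.
by rewrite eq_le le1; lra.
Qed.

(** Without fractional entries [x] is a 0/1 vector. Its support [B] satisfies
    [#|B| = x(B) <= rank B], so it is independent, and its size is the full rank. *)
Lemma integral_rank_polytope x : in_rank_polytope x -> frac x = set0 ->
  exists2 B, B \in bases M & x = indicator B.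
Proof.
move=> xQ fr0; have [x0 xA xT] := xQ; have x1 := rank_polytope_le1 xQ.
have x01 i : x i = (x i == 1)%:R.
  case: eqP => // /eqP ni; apply/eqP; rewrite eq_le x0 andbT leNgt; apply/negP => pi.
  by have := in_set0 i; rewrite -fr0 inE pi lt_neqAle ni x1.
pose B := [set i | x i == 1]; exists B; last by apply/ffunP => i; rewrite ffunE inE -x01.
have cB A : \sum_(i in A) x i = #|A :&: B|%:R.
  under eq_bigr => i _ do rewrite x01.
  rewrite -natr_sum; congr _%:R; rewrite -sum1_card big_mkcond [RHS]big_mkcond.
  by apply: eq_bigr => i _; rewrite !inE; case: (i \in A); case: (x i == 1).
have iB : indep M B.
  by apply: card_rank_indep; rewrite -(ler_nat R); have := xA B; rewrite cB setIid.
have cBT : #|B| = rank M setT.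
  apply/eqP; rewrite -(eqr_nat R) -xT -[B]setTI -cB; apply/eqP.
  by apply: eq_bigl => i; rewrite inE.
case/indepP: (iB) => D DM BD; suff /eqP -> : B == D by [].
by rewrite eqEcard BD cBT rank_ge ?subsetT //; apply/indepP; exists D.
Qed.

Lemma sum_integral x S : in_rank_polytope x -> {in S, forall l, l \notin frac x} ->
  exists m, \sum_(l in S) x l = m%:R.
Proof.
move=> xQ nf; have [x0 _ _] := xQ; have x1 := rank_polytope_le1 xQ.
exists (\sum_(l in S) (x l == 1%R))%N; rewrite natr_sum; apply: eq_bigr => l lS.
have := nf l lS; rewrite inE lt_neqAle [x l < 1]lt_neqAle x0 x1 !andbT negb_and !negbK.
by move=> /orP[/eqP <-|/eqP ->]; rewrite ?eqxx // eq_sym oner_eq0.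
Qed.

(* The pair is taken in a minimal tight set meeting the fractional support. *)
Lemma exists_tight_pair x : in_rank_polytope x -> frac x != set0 ->
  exists i j, [/\ i != j, i \in frac x, j \in frac x
    & forall S, S \in tight x -> (i \in S) = (j \in S)].
Proof.
move=> xQ /set0Pn[i0 fi0].
pose P T := (T \in tight x) && (T :&: frac x != set0).
have PT : P setT by rewrite /P tightT //=; apply/set0Pn; exists i0; rewrite inE fi0 inE.
case: (@arg_minnP _ setT P (fun T => #|T|) PT) => T /andP[tT /set0Pn[i]].
rewrite inE => /andP[iT fi] minT.
have [/exists_inP[j jT /andP[fj ij]]|nj] := boolP [exists j in T, (j \in frac x) && (i != j)].
  have mem S a b : a \in T -> b \in T -> a \in frac x -> S \in tight x -> a \in S -> b \in S.
    move=> aT bT fa tS aS; have : P (S :&: T).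
      by rewrite /P tightI //=; apply/set0Pn; exists a; move: fa; rewrite !inE aS aT.
    move=> /minT le; have /eqP eT : S :&: T == T by rewrite eqEcard subsetIr.
    by move: bT; rewrite -eT inE => /andP[].
  by exists i, j; split=> // S tS; apply/idP/idP; apply: mem.
(* Were [i] the only fractional coordinate in the tight set [T], the sum over [T] would lie strictly
   between two consecutive integers, although it equals a rank. *)
have [|m em] := @sum_integral x (T :\ i) xQ.
  move=> l; rewrite !inE => /andP[li lT]; apply: contra nj => fl.
  by apply/exists_inP; exists l => //; rewrite inE fl eq_sym.
move: tT; rewrite inE (big_setD1 i) //= em; move: fi; rewrite inE => /andP[x0 x1] /eqP e.
have : (m%:R : R) < (rank M T)%:R by lra.
have : (rank M T)%:R < (m.+1%:R : R) by rewrite -natr1; lra.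
by rewrite !ltr_nat; lia.
Qed.

Definition shift x i j (e : R) : {ffun E -> R} :=
  [ffun l => x l + e * ((l == i)%:R - (l == j)%:R)].

Lemma sum_shift x i j e A :
  \sum_(l in A) shift x i j e l = \sum_(l in A) x l + e * ((i \in A)%:R - (j \in A)%:R).
Proof.
under eq_bigr => l _ do rewrite ffunE.
by rewrite big_split /= -mulr_sumr sumrB !sum_pred1_set.
Qed.

(** Weight moves from [j] to [i] until a new inequality becomes tight: either a set containing [i]
    but not [j], or [0 <= x j]. Tight sets contain both or neither of [i] and [j], so they stay
    tight, and zero coordinates are not touched. *)
Lemma shift_rank_polytope x i j : in_rank_polytope x -> i != j ->
    i \in frac x -> j \in frac x -> (forall S, S \in tight x -> (i \in S) = (j \in S)) ->
  exists e, [/\ 0 < e, in_rank_polytope (shift x i j e)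
    & (defect (shift x i j e) < defect x)%N].
Proof.
move=> xQ ij; rewrite !inE => /andP[i0 i1] /andP[j0 j1] tS; have [x0 xA xT] := xQ.
pose P A := (i \in A) && (j \notin A).
have Pi : P [set i] by rewrite /P !inE eqxx eq_sym.
pose A0 := [arg min_(A < [set i] | P A) slack x A]%O.
have [/andP[iA0 jA0] minA0] : P A0 /\ forall A, P A -> slack x A0 <= slack x A.
  by rewrite /A0; case: arg_minP.
have slack_ge0 A : 0 <= slack x A by rewrite subr_ge0.
have slack_gt0 A : P A -> 0 < slack x A.
  move=> /andP[iA jA]; rewrite lt_neqAle slack_ge0 andbT eq_sym subr_eq0 eq_sym.
  apply/negP => tA; have : A \in tight x by rewrite inE.
  by move/tS; rewrite iA (negbTE jA).
pose e := Num.min (slack x A0) (x j); exists e.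
have e0 : 0 < e by rewrite lt_min j0 slack_gt0 // /P iA0.
have ej : e <= x j by rewrite ge_min lexx orbT.
have eA A : P A -> e <= slack x A by move=> /minA0; apply: le_trans; rewrite ge_min lexx.
split=> //.
  split=> [l|A|].
  - rewrite ffunE; have := x0 l; have [->|li] := eqVneq l i.
      by rewrite (negbTE ij) => ?; rewrite subr0 mulr1; lra.
    have [->|lj] := eqVneq l j; first by move=> ?; rewrite sub0r mulrN1; lra.
    by rewrite subr0 mulr0 addr0.
  - rewrite sum_shift; have := xA A; have := eA A; rewrite /P /slack.
    case: (i \in A); case: (j \in A) => /= h1 h2; rewrite ?subrr ?subr0 ?sub0r ?mulr0 ?mulr1 ?mulrN1.
    - lra. - by have := h1 isT; lra. - lra. - lra.
  have allT (g : E -> R) : \sum_(l in [set: E]) g l = \sum_l g l.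
    by apply: eq_bigl => l; rewrite inE.
  by rewrite -xT -allT sum_shift !inE subrr mulr0 addr0 allT.
set x' := shift x i j e.
have sub1 : tight x \subset tight x'.
  apply/subsetP => A tA; have := tS _ tA; move: tA; rewrite !inE sum_shift => /eqP -> ->.
  by rewrite subrr mulr0 addr0.
have sub2 : zeros x \subset zeros x'.
  apply/subsetP => l; rewrite !inE ffunE => /eqP xl.
  have -> : (l == i) = false by apply/eqP => li; move: i0; rewrite -li xl ltxx.
  have -> : (l == j) = false by apply/eqP => lj; move: j0; rewrite -lj xl ltxx.
  by rewrite xl subrr mulr0 addr0.
have [le|gt] := leP (slack x A0) (x j).
  have eE : e = slack x A0 by rewrite /e min_l.
  rewrite /defect -addSn leq_add //; last by rewrite subset_leq_card ?setCS.
  rewrite proper_card // properC; apply/properP; split=> //; exists A0.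
    by rewrite inE sum_shift iA0 (negbTE jA0) subr0 mulr1 eE /slack; apply/eqP; ring.
  by apply/negP => /tS; rewrite iA0 (negbTE jA0).
have eE : e = x j by rewrite /e min_r ?ltW.
rewrite /defect -addnS leq_add //; first by rewrite subset_leq_card ?setCS.
rewrite proper_card // properC; apply/properP; split=> //; exists j.
  by rewrite inE ffunE eqxx [j == i]eq_sym (negbTE ij) eE sub0r mulrN1 subrr.
by rewrite inE gt_eqF.
Qed.

(** A fractional point can be shifted along [e_i - e_j] and along its opposite; it is a convex
    combination of the two results, both of smaller defect. *)
Lemma rank_polytope_ind (C : {ffun E -> R} -> Prop) :
    (forall B, B \in bases M -> C (indicator B)) ->
    (forall x y (t : R), 0 <= t <= 1 -> C x -> C y ->
       C [ffun l => t * x l + (1 - t) * y l]) ->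
  forall x, in_rank_polytope x -> C x.
Proof.
move=> Cb Cc x; have [m] := ubnP (defect x); elim: m x => // m IH x ltm xQ.
have [fr0|frn0] := eqVneq (frac x) set0.
  by have [B BM ->] := integral_rank_polytope xQ fr0; exact: Cb.
have [i [j [ij fi fj tS]]] := exists_tight_pair xQ frn0.
have [e [e0 eQ ed]] := shift_rank_polytope xQ ij fi fj tS.
have ji : j != i by rewrite eq_sym.
have [e' [e'0 e'Q e'd]] := shift_rank_polytope xQ ji fj fi (fun S tSx => esym (tS S tSx)).
have Ce : C (shift x i j e) by apply: IH => //; apply: leq_trans ed _; rewrite -ltnS.
have Ce' : C (shift x j i e') by apply: IH => //; apply: leq_trans e'd _; rewrite -ltnS.
have ee : e + e' != 0 by rewrite gt_eqF // addr_gt0.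
(* This weight is the solution of [t * e = (1 - t) * e'], for which the two shifts cancel. *)
have t01 : 0 <= e' / (e + e') <= 1.
  apply/andP; split; first by rewrite divr_ge0 // ?addr_ge0 ?ltW.
  by rewrite ler_pdivrMr ?addr_gt0 // mul1r lerDr ltW.
have := Cc _ _ _ t01 Ce Ce'; congr C; apply/ffunP => l; rewrite !ffunE.
by field.
Qed.

End Edmonds.

(** * Descents of partial sums modulo [k] *)

Local Open Scope nat_scope.

Definition part_sum (y : nat -> nat) (j : nat) : nat := \sum_(i < j) y i.

Definition num_desc (u : nat -> nat) (j : nat) : nat := \sum_(i < j) (u i.+1 < u i).

Lemma part_sumS y j : part_sum y j.+1 = part_sum y j + y j.
Proof. by rewrite /part_sum big_ord_recr. Qed.

Lemma num_descS u j : num_desc u j.+1 = num_desc u j + (u j.+1 < u j).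
Proof. by rewrite /num_desc big_ord_recr. Qed.

Lemma eq_num_desc u v j : (forall i, i < j -> (u i.+1 < u i) = (v i.+1 < v i)) ->
  num_desc u j = num_desc v j.
Proof. by move=> uv; apply: eq_bigr => i _; rewrite uv. Qed.

(** Adding a term below [k] raises the quotient by at most 1, and does so exactly when the residue
    wraps around, that is, when it descends. *)
Lemma divn_part_sum (y : nat -> nat) k j : 0 < k -> (forall i, i < j -> y i < k) ->
  part_sum y j %/ k = num_desc (fun i => part_sum y i %% k) j.
Proof.
move=> k0; elim: j => [|j IH] yk.
  by rewrite /part_sum /num_desc !big_ord0 div0n.
rewrite num_descS -IH => [|i ij]; last by apply: yk; lia.
rewrite part_sumS; have := yk j (ltnSn j); move: (part_sum y j) (y j) => s t tk.
rewrite divnD // (divn_small tk) addn0 modnD // (modn_small tk); congr (_ + _).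
by have := ltn_pmod s k0; case: (leqP k (s %% k + t)) => /=; lia.
Qed.

(* The word [0 z_1 ... z_n 0]: letters are numbered from 1. *)
Definition frame n (z : 'I_n -> nat) (j : nat) : nat :=
  if j is j'.+1 then oapp z 0 (insub j') else 0.
Arguments frame n z j : simpl never.

Lemma frameS n (z : 'I_n -> nat) (i : 'I_n) : frame z i.+1 = z i.
Proof. by rewrite /frame valK. Qed.

Lemma frame0 n (z : 'I_n -> nat) : frame z 0 = 0.
Proof. by []. Qed.

Lemma frame_last n (z : 'I_n -> nat) : frame z n.+1 = 0.
Proof. by rewrite /frame insubN // ltnn. Qed.

(** Standardisation: for a word without repeated letters, the permutation with the same order
    pattern. *)
Definition standard n (z : 'I_n -> nat) (i : 'I_n) : nat := #|[set j | z j < z i]|.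

Lemma standard_lt n (z : 'I_n -> nat) i : standard z i < n.
Proof.
rewrite -[X in _ < X]card_ord -cardsT; apply: proper_card; apply/properP.
by split; [exact: subsetT|exists i; rewrite ?inE // ltnn].
Qed.

Lemma ltn_standard n (z : 'I_n -> nat) i j : (standard z i < standard z j) = (z i < z j).
Proof.
apply/idP/idP => [|zij]; last first.
  apply: proper_card; apply/properP; split; last by exists i; rewrite !inE ?ltnn.
  by apply/subsetP => l; rewrite !inE => /ltn_trans; apply.
apply: contraTT; rewrite -!leqNgt => zji; apply: subset_leq_card.
by apply/subsetP => l; rewrite !inE => zl; exact: leq_trans zji.
Qed.

Lemma standard_inj n (z : 'I_n -> nat) : injective z -> injective (standard z).
Proof. by move=> zI i j e; apply: zI; have := ltn_standard z i j; have := ltn_standard z j i; lia. Qed.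

Lemma standard_perm n (z : 'I_n -> nat) (w : 'S_n) i :
  standard (fun i => z (w i)) i = standard z (w i).
Proof.
rewrite /standard -(card_imset _ (@perm_inj _ w)); apply: eq_card => j.
apply/imsetP/idP => [[l + ->]|]; first by rewrite !inE.
by rewrite inE => zj; exists (w^-1 j)%g; rewrite ?inE permKV.
Qed.

(** * Generic words are equidistributed over the permutations they standardise to *)

Section WordCount.

Variables (n k : nat).
Hypothesis k_gt0 : 0 < k.
Implicit Types (z : {ffun 'I_n -> 'I_k}) (w : 'S_n).

Local Notation nval z := (fun i => nat_of_ord (z i)).

(** Letters are also required to be nonzero, so that they differ from the framing zeros of
    [frame]. *)
Definition generic z : bool := injectiveb z && [forall i, 0 < z i].

Lemma genericP z : reflect (injective z /\ forall i, 0 < z i) (generic z).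
Proof. by apply: (iffP andP) => -[/injectiveP ? /forallP]. Qed.

Lemma card_generic : #|[set z | generic z]| = k.-1 ^_ n.
Proof.
pose pos := [set j : 'I_k | 0 < j].
have cpos : #|pos| = k.-1.
  have -> : pos = ~: [set Ordinal k_gt0] by apply/setP => j; rewrite !inE lt0n.
  by rewrite cardsC1 card_ord.
rewrite -cpos -[X in _ ^_ X]card_ord -card_inj_ffuns_on; apply: eq_card => z; rewrite !inE andbC.
congr (_ && _); apply/forallP/ffun_onP => [h i|h i]; first by rewrite inE.
by have := h i; rewrite inE.
Qed.

Definition std_ord z (i : 'I_n) : 'I_n := Ordinal (standard_lt (nval z) i).

Lemma std_ord_inj z : generic z -> injective (std_ord z).
Proof.
case/genericP => zI _ i j /(congr1 val) /= /standard_inj; apply.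
by move=> a b /val_inj /zI.
Qed.

(** The identity is a default for words on which the standardisation is not injective. *)
Definition std_perm z : 'S_n :=
  if insub [ffun i => std_ord z i] is Some w then w else 1%g.

Lemma std_permE z i : generic z -> std_perm z i = standard (nval z) i :> nat.
Proof.
move=> gz; rewrite /std_perm insubT.
  by apply/injectiveP => a b; rewrite !ffunE; exact: std_ord_inj.
by move=> p; rewrite -pvalE /= ffunE.
Qed.

Lemma generic_perm z w : generic [ffun i => z (w i)] = generic z.
Proof.
apply/genericP/genericP => -[zI zp].
  split=> [a b e|a]; last by have := zp (w^-1 a)%g; rewrite ffunE permKV.
  have /zI : [ffun i => z (w i)] (w^-1 a)%g = [ffun i => z (w i)] (w^-1 b)%g by rewrite !ffunE !permKV.
  exact: perm_inj.
split=> [a b|a]; last by rewrite ffunE zp.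
by rewrite !ffunE => /zI /perm_inj.
Qed.

Definition std_fiber w : {set {ffun 'I_n -> 'I_k}} :=
  [set z | generic z & std_perm z == w].

Lemma std_perm_comp z w : generic z -> std_perm [ffun i => z (w i)] = (w * std_perm z)%g.
Proof.
move=> gz; apply/permP => i; apply: val_inj; rewrite /= permM !std_permE ?generic_perm //.
by rewrite -standard_perm; apply: eq_card => j; rewrite !inE !ffunE.
Qed.

(** Rearranging the positions by [w] maps the words that standardise to the identity bijectively
    onto those that standardise to [w]. *)
Lemma card_std_fiber w : #|std_fiber w| = #|std_fiber 1%g|.
Proof.
pose h z : {ffun 'I_n -> 'I_k} := [ffun i => z (w i)].
have hI : injective h.
  move=> z z' /ffunP e; apply/ffunP => i.
  by have := e (w^-1 i)%g; rewrite !ffunE permKV.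
rewrite -[RHS](card_imset _ hI); apply: eq_card => z; rewrite !inE; apply/andP/imsetP.
  move=> [gz /eqP sz]; exists [ffun i => z (w^-1 i)%g]; last first.
    by apply/ffunP => i; rewrite !ffunE permK.
  by rewrite !inE generic_perm gz std_perm_comp // sz mulVg eqxx.
case=> z'; rewrite !inE => /andP[gz' /eqP sz'] ->.
by rewrite /h generic_perm std_perm_comp // sz' mulg1.
Qed.

Lemma card_generic_std (W : {set 'S_n}) :
  #|[set z | generic z & std_perm z \in W]| = #|W| * #|std_fiber 1%g|.
Proof.
rewrite -sum1_card (partition_big std_perm (mem W)) /=; last first.
  by move=> z; rewrite inE => /andP[].
rewrite -sum_nat_const; apply: eq_bigr => w wW; rewrite -(card_std_fiber w) sum1_card.
apply: eq_card => z; rewrite !inE -topredE /= inE.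
by case: eqP => [->|]; rewrite ?wW ?andbT ?andbF.
Qed.

Lemma card_generic_std_fact (W : {set 'S_n}) :
  #|[set z | generic z & std_perm z \in W]| * n`! = #|W| * k.-1 ^_ n.
Proof.
have := card_generic_std setT.
have -> : [set z | generic z & std_perm z \in setT] = [set z | generic z].
  by apply/setP => z; rewrite !inE andbT.
rewrite card_generic cardsT card_Sn card_generic_std => ->; lia.
Qed.

Definition word_desc (u : 'I_n -> nat) := num_desc (frame u).

(** Standardising preserves comparisons of neighbouring letters; the successor keeps the letters of
    the permutation above the framing zeros, so the first and last comparisons agree as well. *)
Lemma word_desc_std z j : generic z -> j <= n.+1 ->
  word_desc (nval z) j = word_desc (fun i => (std_perm z i).+1) j.
Proof.
move=> gz jn; apply: eq_num_desc => i ij; have [_ zp] := genericP _ gz.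
case: i ij => [|i] ij //.
have ltin : i < n by lia.
rewrite (frameS (nval z) (Ordinal ltin)) (frameS (fun i => (std_perm z i).+1) (Ordinal ltin)).
have [->|ni] := eqVneq i.+1 n; first by rewrite !frame_last zp.
have ltin1 : i.+1 < n by lia.
rewrite (frameS (nval z) (Ordinal ltin1)) (frameS (fun i => (std_perm z i).+1) (Ordinal ltin1)).
by rewrite ltnS !std_permE // ltn_standard.
Qed.

End WordCount.

(** * Integer points encoded by their partial sums modulo [k] *)

Section SumCount.

Variables (n k d : nat) (F : {set {set 'I_n.+1}}) (rho : {set 'I_n.+1} -> nat).
Hypotheses (n_gt0 : 0 < n) (k_gt0 : 0 < k).
Implicit Types (z : {ffun 'I_n -> 'I_k}) (y : {ffun 'I_n.+1 -> 'I_k.+1}).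

Definition nat_fun y (i : nat) : nat := y (inord i).

Lemma nat_fun_le y i : nat_fun y i <= k.
Proof. by rewrite -ltnS ltn_ord. Qed.

(** Only the cardinality of [A] enters the left-hand side: the members of the chain are meant to be
    initial segments after a reordering. *)
Definition prefix_bounded y : bool :=
  (part_sum (nat_fun y) n.+1 == d.+1 * k) &&
  [forall A in F, part_sum (nat_fun y) #|A| <= rho A * k].

(** The bound is strict because for a generic word the partial sum [s] at an inner cut is not a
    multiple of [k], and then [s <= rho A * k] amounts to [s %/ k < rho A]. *)
Definition desc_bounded (u : 'I_n -> nat) : bool :=
  (word_desc u n.+1 == d.+1) &&
  [forall A in F, (0 < #|A| <= n) ==> (word_desc u #|A| < rho A)].

Definition sums_mod y : {ffun 'I_n -> 'I_k} :=
  [ffun i => Ordinal (ltn_pmod (part_sum (nat_fun y) (nat_of_ord i).+1) k_gt0)].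

Local Notation nval z := (fun i => nat_of_ord (z i)).

Lemma frame_sums_mod y j : part_sum (nat_fun y) n.+1 = d.+1 * k -> j <= n.+1 ->
  frame (nval (sums_mod y)) j = part_sum (nat_fun y) j %% k.
Proof.
move=> sy; case: j => [_|j]; first by rewrite /= /part_sum big_ord0 mod0n.
rewrite ltnS leq_eqVlt => /orP[/eqP ->|jn]; first by rewrite frame_last sy modnMl.
by rewrite (frameS (nval (sums_mod y)) (Ordinal jn)) ffunE.
Qed.

(** Its residue determines a coordinate in [[0, k]] except for 0 against [k]; this records which of
    the two occurs. *)
Definition full_at y : {ffun 'I_n.+1 -> bool} := [ffun i => y i == k :> nat].

Lemma sums_mod_inj y y' : part_sum (nat_fun y) n.+1 = d.+1 * k ->
  part_sum (nat_fun y') n.+1 = d.+1 * k ->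
  sums_mod y = sums_mod y' -> full_at y = full_at y' -> y = y'.
Proof.
move=> sy sy' ez /ffunP ef; apply/ffunP => i; apply: val_inj => /=.
have congS j : j <= n.+1 -> part_sum (nat_fun y) j = part_sum (nat_fun y') j %[mod k].
  by move=> jn; rewrite -!frame_sums_mod // ez.
have := congS _ (ltn_ord i); rewrite !part_sumS => e1.
have e2 := congS i (ltnW (ltn_ord i)).
have : nat_fun y i = nat_fun y' i %[mod k].
  apply/eqP; rewrite -(eqn_modDl (part_sum (nat_fun y) i)) e1.
  by rewrite -modnDml -e2 modnDml.
have := ef i; rewrite !ffunE /nat_fun inord_val.
have := ltn_ord (y i); have := ltn_ord (y' i).
case: eqP => [->|ny]; case: eqP => [->|ny'] // lt' lt _.
by rewrite !modn_small //; lia.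
Qed.

(** A coordinate equal to [k] repeats a letter of the framed word, while the letters of a generic
    word are distinct and differ from the framing zeros. *)
Lemma generic_not_full y : part_sum (nat_fun y) n.+1 = d.+1 * k ->
  generic (sums_mod y) -> forall i, i < n.+1 -> nat_fun y i < k.
Proof.
move=> sy /genericP[zI zp] i ltin; rewrite ltn_neqAle nat_fun_le andbT; apply/eqP => yk.
have e : frame (nval (sums_mod y)) i.+1 = frame (nval (sums_mod y)) i.
  by rewrite !frame_sums_mod // 1?ltnW // part_sumS yk modnDr.
case: i ltin {yk} e => [_|i ltin].
  by rewrite (frameS _ (Ordinal n_gt0)) frame0; have := zp (Ordinal n_gt0); lia.
have ltin' : i < n by lia.
rewrite (frameS _ (Ordinal ltin')); have [->|ni] := eqVneq i.+1 n.
  by rewrite frame_last; have := zp (Ordinal ltin'); lia.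
have lti1 : i.+1 < n by lia.
rewrite (frameS _ (Ordinal lti1)) => /val_inj /zI /(congr1 val) /=; lia.
Qed.

Lemma desc_sums_mod y j : part_sum (nat_fun y) n.+1 = d.+1 * k -> j <= n.+1 ->
    (forall i, i < n.+1 -> nat_fun y i < k) ->
  word_desc (nval (sums_mod y)) j = part_sum (nat_fun y) j %/ k.
Proof.
move=> sy jn ylt; rewrite divn_part_sum // => [|i ij]; last by apply: ylt; lia.
by apply: eq_num_desc => i ij; rewrite !frame_sums_mod //; lia.
Qed.

Lemma prefix_desc_bounded y : prefix_bounded y -> generic (sums_mod y) ->
  desc_bounded (nval (sums_mod y)).
Proof.
move=> /andP[/eqP sy /forall_inP bF] gy; have ylt := generic_not_full sy gy.
have [_ zp] := genericP _ gy.
rewrite /desc_bounded desc_sums_mod // sy mulnK // eqxx /=.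
apply/forall_inP => A AF; apply/implyP => /andP[A0 An].
rewrite desc_sums_mod // 1?leqW // ltn_divLR // ltn_neqAle bF // andbT.
have pn : #|A|.-1 < n by rewrite prednK.
apply: contraTneq (zp (Ordinal pn)) => e.
have := frameS (nval (sums_mod y)) (Ordinal pn); rewrite /= prednK // frame_sums_mod // 1?leqW //.
by rewrite e modnMl => <-; rewrite ltnn.
Qed.

(** A section of [sums_mod]: differences of consecutive letters modulo [k], with [k] added so that
    the subtraction stays in the natural numbers. *)
Definition diffs_mod z : {ffun 'I_n.+1 -> 'I_k.+1} :=
  [ffun i : 'I_n.+1 => inord ((frame (nval z) i.+1 + (k - frame (nval z) i)) %% k)].

Lemma frame_lt z j : frame (nval z) j < k.
Proof. by case: j => //= j; rewrite /frame; case: insub => //= i; rewrite ltn_ord. Qed.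

Lemma nat_fun_diffs_mod z i : i < n.+1 ->
  nat_fun (diffs_mod z) i = (frame (nval z) i.+1 + (k - frame (nval z) i)) %% k.
Proof.
by move=> ltin; rewrite /nat_fun ffunE inordK ?inordK // ltnS ltnW // ltn_pmod.
Qed.

Lemma part_sum_diffs_mod z j : j <= n.+1 ->
  part_sum (nat_fun (diffs_mod z)) j %% k = frame (nval z) j.
Proof.
elim: j => [_|j IH ltjn]; first by rewrite /part_sum big_ord0 mod0n.
rewrite part_sumS nat_fun_diffs_mod // modnDmr -modnDml IH 1?ltnW //.
have ltj := frame_lt z j; rewrite addnCA subnKC 1?ltnW // modnDr.
by rewrite modn_small // frame_lt.
Qed.

Lemma desc_prefix_bounded z : rho setT = d.+1 -> generic z -> desc_bounded (nval z) ->
  exists2 y, prefix_bounded y & sums_mod y = z.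
Proof.
move=> rT gz /andP[/eqP dT /forall_inP bF]; exists (diffs_mod z); last first.
  apply/ffunP => i; apply: val_inj; rewrite ffunE /= part_sum_diffs_mod ?frameS //.
  by rewrite leqW.
have ylt i : i < n.+1 -> nat_fun (diffs_mod z) i < k.
  by move=> ltin; rewrite nat_fun_diffs_mod // ltn_pmod.
have dE j : j <= n.+1 -> part_sum (nat_fun (diffs_mod z)) j %/ k = word_desc (nval z) j.
  move=> jn; rewrite divn_part_sum // => [|i ij]; last by apply: ylt; lia.
  by apply: eq_num_desc => i ij; rewrite !part_sum_diffs_mod //; lia.
have sT : part_sum (nat_fun (diffs_mod z)) n.+1 = d.+1 * k.
  by rewrite (divn_eq (part_sum _ _) k) part_sum_diffs_mod // frame_last dE // dT addn0.
rewrite /prefix_bounded sT eqxx; apply/forall_inP => A AF.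
have [cA|nA] := eqVneq #|A| n.+1.
  have -> : A = setT by apply/eqP; rewrite eqEcard subsetT cardsT card_ord cA /=.
  by rewrite cardsT card_ord sT rT.
have [->|A0] := posnP #|A|; first by rewrite /part_sum big_ord0.
have An : #|A| <= n by rewrite -ltnS ltn_neqAle nA -[X in _ <= X]card_ord max_card.
have := bF A AF; rewrite A0 An /= -dE 1?leqW // ltn_divLR //; exact: ltnW.
Qed.

(** On the points with generic word, [sums_mod] is a bijection onto the generic words with bounded
    descents. The other points inject, through [full_at] and [sums_mod], into pairs of a set of
    positions and a non-generic word; this gives the bound on [e]. *)
Lemma card_prefix_bounded : rho setT = d.+1 ->
  exists2 e, e <= 2 ^ n.+1 * (k ^ n - k.-1 ^_ n)
    & #|[set y | prefix_bounded y]| =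
      #|[set z : {ffun 'I_n -> 'I_k} | generic z & desc_bounded (nval z)]| + e.
Proof.
move=> rT; pose S := [set y | prefix_bounded y]; pose G := [set y | generic (sums_mod y)].
have sumS y : y \in S -> part_sum (nat_fun y) n.+1 = d.+1 * k.
  by rewrite inE => /andP[/eqP].
exists #|S :\: G|; last first.
  rewrite -(cardsID G S); congr (_ + _).
  have <- : sums_mod @: (S :&: G) = [set z : {ffun 'I_n -> 'I_k} | generic z & desc_bounded (nval z)].
    apply/setP => z; apply/imsetP/idP => [[y]|].
      by rewrite !inE => /andP[yS yG] ->; rewrite yG prefix_desc_bounded.
    rewrite inE => /andP[gz /(desc_prefix_bounded rT gz)[y yS yz]].
    by exists y; rewrite // !inE yS yz.
  rewrite card_in_imset // => y y' /setIP[yS yG] /setIP[yS' yG'].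
  rewrite !inE in yG yG'.
  move=> /(sums_mod_inj (sumS _ yS) (sumS _ yS')); apply; apply/ffunP => i; rewrite !ffunE.
  have := generic_not_full (sumS _ yS) yG (ltn_ord i).
  have := generic_not_full (sumS _ yS') yG' (ltn_ord i).
  by rewrite /nat_fun inord_val => /ltn_eqF -> /ltn_eqF ->.
pose h y := (full_at y, sums_mod y).
have hI : {in S :\: G &, injective h}.
  move=> y y' /setDP[yS _] /setDP[yS' _] [ef ez].
  exact: (sums_mod_inj (sumS _ yS) (sumS _ yS')).
rewrite -(card_in_imset hI).
have -> : k ^ n - k.-1 ^_ n = #|~: [set z : {ffun 'I_n -> 'I_k} | generic z]|.
  by rewrite cardsCs setCK card_generic // card_ffun !card_ord.
have -> : 2 ^ n.+1 = #|[set: {ffun 'I_n.+1 -> bool}]|.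
  by rewrite cardsT card_ffun card_bool card_ord.
rewrite -cardsX; apply: subset_leq_card; apply/subsetP => _ /imsetP[y /setDP[_ yG] ->].
by rewrite !inE in yG *.
Qed.

End SumCount.

Lemma sum_nth_take (a : seq bool) j : \sum_(i < j) nth false a i = count id (take j a).
Proof.
elim: a j => [|x a IH] [|j] /=; rewrite ?big_ord0 //.
  by rewrite big1 // => i _; rewrite nth_nil.
by rewrite big_ord_recl /= -IH.
Qed.

(** * Descent sequences and descents of framed words *)

Section DescentSeq.

Variables (n d : nat) (F : {set {set 'I_n.+1}}) (rho : {set 'I_n.+1} -> nat).
Hypotheses (n_gt0 : 0 < n) (rhoT : rho setT = d.+1).

Lemma nth_perm_word (w : 'S_n) (i : 'I_n) : nth 0 (perm_word w) i = (w i).+1.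
Proof. by rewrite (nth_map i) ?size_enum_ord // nth_ord_enum. Qed.

Lemma size_descent_seq (w : 'S_n) : size (descent_seq w) = n.+1.
Proof. exact: size_mkseq. Qed.

Lemma nth_descent_seq (w : 'S_n) i : 0 < i < n ->
  nth false (descent_seq w) i = (frame (fun i => (w i).+1) i.+1 < frame (fun i => (w i).+1) i).
Proof.
case: i => [//|i] /andP[_ ltin]; rewrite nth_mkseq; last by lia.
have -> : (i.+1 == n) = false by apply/eqP; lia.
have lti : i < n by lia.
rewrite /= (nth_perm_word w (Ordinal ltin)) (nth_perm_word w (Ordinal lti)).
by rewrite (frameS (fun i => (w i).+1) (Ordinal ltin)) (frameS (fun i => (w i).+1) (Ordinal lti)).
Qed.

Lemma nth_descent_seq0 (w : 'S_n) : nth false (descent_seq w) 0.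
Proof. by rewrite nth_mkseq. Qed.

Lemma nth_descent_seqn (w : 'S_n) : nth false (descent_seq w) n = false.
Proof. by rewrite nth_mkseq // eqxx; case: eqP n_gt0 => // ->. Qed.

(** The framed word begins with an ascent from 0, whereas the descent sequence begins with 1. This
    extra one turns the strict bound in [desc_bounded] into a weak one. *)
Lemma sum_descent_seq (w : 'S_n) a : 0 < a <= n ->
  \sum_(i < a) nth false (descent_seq w) i = (word_desc (fun i => (w i).+1) a).+1.
Proof.
rewrite -/(part_sum (fun i => nth false (descent_seq w) i) a).
case: a => [//|a] /andP[_]; elim: a => [|a IH] lta.
  by rewrite /word_desc num_descS part_sumS /num_desc /part_sum !big_ord0 nth_descent_seq0 ltn0.
rewrite part_sumS IH 1?ltnW // /word_desc [in RHS]num_descS addSn.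
by rewrite nth_descent_seq ?lta.
Qed.

(** The fall from the last letter to the closing 0 makes up for the leading one of the descent
    sequence. *)
Lemma count_descent_seq (w : 'S_n) :
  count id (descent_seq w) = word_desc (fun i => (w i).+1) n.+1.
Proof.
rewrite -[descent_seq w]take_size size_descent_seq -sum_nth_take big_ord_recr /=.
rewrite sum_descent_seq ?n_gt0 ?leqnn // nth_descent_seqn addn0.
rewrite /word_desc num_descS frame_last; have pn : n.-1 < n by rewrite prednK.
by have := frameS (fun i => (w i).+1) (Ordinal pn); rewrite /= prednK // => ->; rewrite addn1.
Qed.

Lemma descent_seq_bounded (w : 'S_n) :
  (count id (descent_seq w) == d.+1) &&
  [forall A in F, \sum_(i < #|A|) nth false (descent_seq w) i <= rho A] =
  desc_bounded d F rho (fun i => (w i).+1).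
Proof.
rewrite /desc_bounded count_descent_seq; apply: andb_id2l => /eqP dT.
apply: eq_forallb_in => A AF; have [->|A0] := posnP #|A|; first by rewrite big_ord0.
have [An|nA] := leqP #|A| n; first by rewrite sum_descent_seq ?A0 // An.
have cA : #|A| = n.+1 by apply/eqP; rewrite eqn_leq nA -[X in _ <= X]card_ord max_card.
have -> : A = setT by apply/eqP; rewrite eqEcard subsetT cardsT card_ord cA /=.
rewrite cardsT card_ord rhoT sum_nth_take -[X in take X](size_descent_seq w) take_size.
by rewrite count_descent_seq dT leqnn.
Qed.

End DescentSeq.

(** * Binary sequence of a chain *)

(** Every descent sequence starts with 1 and ends with 0, so membership in [in_L] only constrains
    the number of ones. *)
Lemma delta_leE d n (b : seq bool) : 0 < n ->
  delta_le d n b =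
  #|[set w : 'S_n | (count id (descent_seq w) == d.+1) && bin_le n (descent_seq w) b]|.
Proof.
move=> n0; pose dt (w : 'S_n) := Tuple (introT eqP (size_descent_seq w)).
rewrite -sum1_card (partition_big dt (fun a => in_L d a && bin_le n a b)) /=; last first.
  move=> w; rewrite inE => /andP[cw ->]; rewrite andbT; apply/and3P; split=> //.
  exact: negbT (nth_descent_seqn n0 w).
apply: eq_bigr => a La; rewrite sum1_card; apply: eq_card => w.
rewrite !inE -topredE /= !inE; apply/eqP/andP => [ea|[_ /eqP/(congr1 val)]//].
have {}ea : dt w = a by apply: val_inj.
split; last exact/eqP.
by case/andP: La => /and3P[cw _ _] lew; rewrite -ea in cw lew; apply/andP; split.
Qed.

Lemma count_take_block m p q :
  count id (take m (nseq p true ++ nseq q false)) = minn m p.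
Proof.
elim: p m => [|p IH] m; first by rewrite minn0; elim: q m => [|q IHq] [|m] //=; rewrite IHq.
by case: m => [|m] /=; rewrite ?min0n // IH add1n minnSS.
Qed.

Section ChainBin.

Variables (E : finType) (M : matroid E).
Implicit Types (A B : {set E}) (s : seq {set E}).

Local Notation blocks A s := (flatten (pairmap (bin_block M) A s)).

Lemma size_bin_block A B : A \subset B -> size (bin_block M A B) = #|B| - #|A|.
Proof.
move=> AB; rewrite size_cat !size_nseq subnKC //; exact: rank_diff.
Qed.

Lemma count_bin_block A B : count id (bin_block M A B) = rank M B - rank M A.
Proof. by rewrite count_cat !count_nseq mul1n mul0n addn0. Qed.

Lemma subset_trans_rel : transitive (fun A B : {set E} => A \subset B).
Proof. by move=> B A C; exact: subset_trans. Qed.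

Lemma count_take_blocks A0 s A : path (fun A B => A \subset B) A0 s -> A \in A0 :: s ->
  count id (take (#|A| - #|A0|) (blocks A0 s)) = rank M A - rank M A0.
Proof.
elim: s A0 => [|A1 s IH] A0.
  by move=> _; rewrite mem_seq1 => /eqP ->; rewrite !subnn take0.
move=> /= /andP[A01 pth]; rewrite in_cons => /orP[/eqP ->|AS].
  by rewrite !subnn take0.
have A1A : A1 \subset A.
  move: AS; rewrite in_cons => /orP[/eqP ->|As] //.
  by have /allP := order_path_min subset_trans_rel pth; apply.
have c01 := subset_leq_card A01; have c1 := subset_leq_card A1A.
rewrite take_cat size_bin_block // ltnNge leq_sub2r //= count_cat count_bin_block.
have -> : #|A| - #|A0| - (#|A1| - #|A0|) = #|A| - #|A1| by lia.
by rewrite IH // addnC addnBA ?subnK ?(rankS M).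
Qed.

(** Inside a block the bounding path climbs with slope one and then stays at the rank of the next
    member. A path [c] with steps 0 or 1 is below the climbing part because of its value at the left
    end, and below the level part because of its value at the right end. *)
Lemma le_count_take_blocks (c : nat -> nat) A0 s :
    (forall j, c j <= c j.+1 <= (c j).+1) -> path (fun A B => A \subset B) A0 s ->
    {in A0 :: s, forall A, c #|A| <= rank M A} ->
  forall j, #|A0| <= j <= #|last A0 s| ->
    c j <= rank M A0 + count id (take (j - #|A0|) (blocks A0 s)).
Proof.
move=> cs; have cD i m : c i <= c (i + m) <= c i + m.
  elim: m => [|m IH]; first by rewrite !addn0 leqnn.
  by rewrite addnS; have := cs (i + m); lia.
elim: s A0 => [|A1 s IH] A0 /=.
  move=> _ cA j /andP[le1 le2]; have -> : j = #|A0| by lia.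
  by rewrite addn0 cA ?mem_head.
move=> /andP[A01 pth] cA j /andP[le1 le2].
have c01 := subset_leq_card A01; have r01 := rankS M A01.
have cA0 := cA A0 (mem_head _ _); have cA1 : c #|A1| <= rank M A1 by rewrite cA ?inE ?eqxx ?orbT.
rewrite take_cat size_bin_block //; case: ltnP => [ltj|lej].
  rewrite count_take_block; have := cD #|A0| (j - #|A0|); have := cD j (#|A1| - j).
  by rewrite !subnKC //; lia.
rewrite count_cat count_bin_block addnA subnKC //.
have -> : j - #|A0| - (#|A1| - #|A0|) = j - #|A1| by lia.
by apply: IH => //; [move=> A As; apply: cA; rewrite in_cons As orbT|lia].
Qed.

Lemma chain_seqE (F : anchored_chain M) : exists s,
  [/\ chain_seq F = set0 :: s, path (fun A B => A \subset B) set0 s,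
      (forall A, (A \in set0 :: s) = (A \in chain_set F)) & last set0 s = setT].
Proof.
have [F0 FT cF /is_chainP chF] := anchored_chainP F.
have memS A : (A \in chain_seq F) = (A \in chain_set F) by rewrite mem_sort mem_enum.
have srt : sorted (fun A B => A \subset B) (chain_seq F).
  apply: (@sub_in_sorted _ (mem (chain_set F)) (fun A B : {set E} => #|A| <= #|B|)).
  - move=> A B AF BF le; have /orP[//|BA] := chF _ _ AF BF.
    by suff /eqP -> : B == A by []; rewrite eqEcard BA.
  - by apply/allP => A; rewrite memS.
  - by apply: sort_sorted => A B; exact: leq_total.
case e: (chain_seq F) srt memS => [|A0 s] /=; first by move=> _ /(_ set0); rewrite F0.
move=> pth memS; have A00 : A0 = set0.
  have := memS set0; rewrite F0 in_cons => /orP[/eqP //|s0].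
  have /allP/(_ _ s0) := order_path_min subset_trans_rel pth.
  by rewrite subset0 => /eqP.
rewrite A00 in pth memS *; exists s; split=> //.
have : setT \in set0 :: s by rewrite memS.
rewrite -index_mem => ltT; apply/eqP; rewrite eqEsubset subsetT /=.
have Ts : setT \in set0 :: s by rewrite memS.
case/splitPl: Ts pth => p1 p2 lastp; rewrite cat_path last_cat lastp => /andP[_].
case/lastP: p2 => [|p2 B] //=; rewrite last_rcons => /(order_path_min subset_trans_rel)/allP; apply.
by rewrite mem_rcons mem_head.
Qed.

End ChainBin.

(** At position [#|A|] the prefix count of the binary sequence is exactly [rank M A]. As each block
    lists its ones first, the sequence is the largest one with these values, so comparing at the
    members of the chain suffices. *)
Lemma bin_le_chain_bin n (M : matroid 'I_n.+1) (F : anchored_chain M) (a : seq bool) :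
  bin_le n a (chain_bin F) =
  [forall A in chain_set F, \sum_(i < #|A|) nth false a i <= rank M A].
Proof.
have [s [eS pth memS lastS]] := chain_seqE F.
rewrite /bin_le /chain_bin eS /=; set b := flatten _.
apply/forallP/forall_inP => [h A AF|h j].
  have [->|A0] := posnP #|A|; first by rewrite big_ord0.
  have pA : #|A|.-1 < n.+1 by rewrite prednK // -[X in _ <= X]card_ord max_card.
  have := h (Ordinal pA); rewrite /= prednK // => /leq_trans; apply.
  have := count_take_blocks M pth; move=> /(_ A); rewrite memS AF => /(_ isT).
  by rewrite cards0 subn0 rank0 subn0 sum_nth_take => ->.
rewrite [X in _ <= X]sum_nth_take.
pose c j := \sum_(i < j) nth false a i.
have cs i : c i <= c i.+1 <= (c i).+1 by rewrite /c big_ord_recr /=; case: (nth _ _ _); lia.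
have cA : {in set0 :: s, forall A : {set 'I_n.+1}, c #|A| <= rank M A} by move=> A; rewrite memS; exact: h.
have := le_count_take_blocks cs pth cA (j := j.+1); rewrite cards0 subn0 rank0 add0n; apply.
by rewrite lastS cardsT card_ord ltn_ord.
Qed.

(** * Counting points of the dilated chain polytopes *)

Section Reorder.

Variables (n : nat) (F : {set {set 'I_n.+1}}).
Hypothesis chF : is_chain F.

(** Counts the members missing [x]. It grows with the stage at which [x] enters the chain, so
    sorting by it turns the members into initial segments. *)
Let key (x : 'I_n.+1) : nat := #|[set A in F | x \notin A]|.

Lemma ltn_key A x y : A \in F -> x \in A -> y \notin A -> key x < key y.
Proof.
move=> AF xA yA; apply: proper_card; apply/properP; split; last first.
  by exists A; rewrite !inE AF // xA.
apply/subsetP => B; rewrite !inE => /andP[BF xB]; rewrite BF /=.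
have /orP[BA|AB] := is_chainP _ chF _ _ BF AF; last by rewrite (subsetP AB) in xB.
by apply: contra yA; exact: (subsetP BA).
Qed.

Lemma card_down_set (D : {set 'I_n.+1}) :
    (forall i j : 'I_n.+1, i <= j -> j \in D -> i \in D) ->
  forall i : 'I_n.+1, (i \in D) = (i < #|D|).
Proof.
move=> down i; have card_lt m : m <= n.+1 -> #|[set j : 'I_n.+1 | j < m]| = m.
  move=> mn; rewrite -sum1_card (eq_bigl (fun j : 'I_n.+1 => j < m)) => [|j]; last by rewrite inE.
  by rewrite -(big_ord_widen _ (fun=> 1)) // sum1_card card_ord.
apply/idP/idP => [iD|].
  rewrite -(card_lt i.+1) //; apply: subset_leq_card.
  by apply/subsetP => j; rewrite inE ltnS => ji; exact: down ji iD.
apply: contraTT => iD; rewrite -leqNgt -[X in _ <= X](card_lt i (ltnW (ltn_ord i))).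
apply: subset_leq_card; apply/subsetP => j jD; rewrite inE ltnNge.
by apply: contra iD => ij; exact: down ij jD.
Qed.

Lemma chain_reorder : exists s : 'S_n.+1,
  forall A, A \in F -> forall i, (s i \in A) = (i < #|A|).
Proof.
pose l := sort (fun x y => key x <= key y) (enum 'I_n.+1).
have sl : size l = n.+1 by rewrite size_sort size_enum_ord.
pose g (i : 'I_n.+1) := nth ord0 l i.
have gI : injective g.
  move=> i j /eqP; rewrite nth_uniq ?sl ?sort_uniq ?enum_uniq // => /eqP.
  exact: val_inj.
exists (perm gI) => A AF i.
have -> : #|A| = #|[set j | perm gI j \in A]|.
  have -> : [set j | perm gI j \in A] = (perm gI)^-1%g @: A.
    apply/setP => j; rewrite inE; apply/idP/imsetP => [jA|[x xA ->]]; last by rewrite permKV.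
    by exists (perm gI j); rewrite ?permK.
  by rewrite card_imset //; exact: perm_inj.
have -> : (perm gI i \in A) = (i \in [set j | perm gI j \in A]) by rewrite inE.
apply: card_down_set => {}i j ij; rewrite !inE !permE => jA; apply: contraT => iA.
have := ltn_key AF jA iA; rewrite ltnNge => /negP[].
have := sort_sorted (fun x y => leq_total (key x) (key y)) (enum 'I_n.+1).
move=> /(sorted_leq_nth (fun x y z => @leq_trans (key x) (key y) (key z)) (fun x => leqnn (key x))).
by move=> /(_ ord0); apply; rewrite ?inE ?sl.
Qed.

End Reorder.

Section ChainCount.

Variables (n d k : nat) (M : matroid 'I_n.+1).
Hypotheses (n_gt0 : 0 < n) (k_gt0 : 0 < k) (M_rank : matroid_rank M = d.+1).

Definition chain_points (F : anchored_chain M) : {set {ffun 'I_n.+1 -> 'I_k.+1}} :=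
  [set y : {ffun 'I_n.+1 -> 'I_k.+1} | (\sum_i y i == d.+1 * k) &&
    [forall A in chain_set F, \sum_(i in A) y i <= rank M A * k]].

Lemma card_chain_points_prefix (F : anchored_chain M) :
  #|chain_points F| =
  #|[set y : {ffun 'I_n.+1 -> 'I_k.+1} | prefix_bounded d (chain_set F) (rank M) y]|.
Proof.
have [_ _ _ chF] := anchored_chainP F; have [s sP] := chain_reorder chF.
pose h (y : {ffun 'I_n.+1 -> 'I_k.+1}) := [ffun i => y (s i)].
have hI : injective h.
  move=> y y' /ffunP e; apply/ffunP => i.
  by have := e (s^-1 i)%g; rewrite !ffunE permKV.
have sumE y m : m <= n.+1 -> part_sum (nat_fun (h y)) m = \sum_(i < n.+1 | i < m) y (s i).
  move=> mn; rewrite /part_sum (big_ord_widen n.+1 (nat_fun (h y))) //.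
  by apply: eq_bigr => i _; rewrite /nat_fun inord_val ffunE.
rewrite -[LHS](card_imset _ hI); apply: eq_card => y'; rewrite inE.
have hP y : (y \in chain_points F) = prefix_bounded d (chain_set F) (rank M) (h y).
  rewrite inE /prefix_bounded sumE //; congr (_ && _).
    rewrite (reindex_inj (@perm_inj _ s)) /=; congr (_ == _).
    by apply: eq_bigl => i; rewrite ltn_ord.
  apply: eq_forallb_in => A AF; rewrite sumE; last by rewrite -[X in _ <= X]card_ord max_card.
  rewrite (reindex_inj (@perm_inj _ s)) /=; congr (_ <= _).
  by apply: eq_bigl => i; rewrite sP.
apply/imsetP/idP => [[y yF ->]|py']; first by rewrite -hP.
have ey : h [ffun i => y' (s^-1 i)%g] = y' by apply/ffunP => i; rewrite !ffunE permK.
by exists [ffun i => y' (s^-1 i)%g]; rewrite ?hP ey.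
Qed.

(** Here [g] counts generic words and [e] the remaining points; the factor [n!] avoids a division in
    the natural numbers. *)
Lemma card_chain_points (F : anchored_chain M) :
  exists g e, [/\ #|chain_points F| = g + e,
    g * n`! = delta_le d n (chain_bin F) * k.-1 ^_ n & e <= 2 ^ n.+1 * (k ^ n - k.-1 ^_ n)].
Proof.
have [e le_e ce] := card_prefix_bounded (chain_set F) n_gt0 k_gt0 M_rank.
pose W := [set w : 'S_n | desc_bounded d (chain_set F) (rank M) (fun i => (w i).+1)].
exists #|[set z : {ffun 'I_n -> 'I_k} | generic z & desc_bounded d (chain_set F) (rank M) (fun i => z i)]|.
exists e; split=> //; first by rewrite card_chain_points_prefix.
have -> : delta_le d n (chain_bin F) = #|W|.
  rewrite delta_leE //; apply: eq_card => w; rewrite !inE -(descent_seq_bounded _ n_gt0 M_rank).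
  by rewrite bin_le_chain_bin.
rewrite -(card_generic_std_fact k_gt0); congr (_ * _); apply: eq_card => z; rewrite !inE.
apply: andb_id2l => gz; rewrite /desc_bounded (word_desc_std k_gt0 gz) //; congr (_ && _).
apply: eq_forallb_in => A AF; case: (boolP (_ < _ <= _)) => // /andP[_ An].
by rewrite /= (word_desc_std k_gt0 gz) // leqW.
Qed.

End ChainCount.

Local Open Scope ring_scope.

(** * Points of the dilated base polytope as a signed sum over chains *)

Section FlatPoints.

Variables (n d k : nat) (M : matroid 'I_n.+1).
Hypotheses (n_gt0 : (0 < n)%N) (conM : matroid_connected M) (M_rank : matroid_rank M = d.+1).
Implicit Types (y : {ffun 'I_n.+1 -> 'I_k.+1}) (A B X : {set 'I_n.+1}).

Definition rank_points : {set {ffun 'I_n.+1 -> 'I_k.+1}} :=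
  [set y : {ffun 'I_n.+1 -> 'I_k.+1} | (\sum_i y i == d.+1 * k)%N &&
    [forall A : {set 'I_n.+1}, \sum_(i in A) y i <= rank M A * k]%N].

Let f y A : int := (rank M A * k)%N%:Z - (\sum_(i in A) y i)%N%:Z.

Let f_ge0 y A : (0 <= f y A) = (\sum_(i in A) y i <= rank M A * k)%N.
Proof. by rewrite /f subr_ge0 lez_nat. Qed.

Let f_submod y A B : f y (A :|: B) + f y (A :&: B) <= f y A + f y B.
Proof.
have aux (a b c e s1 s2 s3 s4 : nat) : (a + b <= c + e)%N -> (s1 + s2 = s3 + s4)%N ->
  a%:Z - s1%:Z + (b%:Z - s2%:Z) <= c%:Z - s3%:Z + (e%:Z - s4%:Z) by lia.
apply: aux; first by rewrite -!mulnDl leq_mul // rank_submod.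
exact: big_setUI.
Qed.

Let f_span y X : f y (span M X) <= f y X.
Proof.
rewrite /f rank_span lerD2l lerN2 lez_nat [X in (_ <= X)%N](big_setID X) /=.
by rewrite (setIidPr (sub_span M X)) leq_addr.
Qed.

Let f_cyc y X : f y (cyc M X) <= f y X.
Proof.
have aux (a b c s t : nat) : (a + b <= c)%N -> (t <= b)%N ->
  a%:Z - s%:Z <= c%:Z - (s + t)%N%:Z by lia.
rewrite /f [in leRHS](big_setID (cyc M X)) /= (setIidPr (cyc_sub M X)).
apply: (aux _ (#|X :\: cyc M X| * k)%N); first by rewrite -mulnDl leq_mul // rank_cyc.
by rewrite -sum_nat_const leq_sum // => i _; rewrite -ltnS ltn_ord.
Qed.

Lemma rank_pointsE y : (y \in rank_points) =
  (\sum_i y i == d.+1 * k)%N && [forall (A | cyclic_flat M A), 0 <= f y A].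
Proof.
rewrite inE; congr (_ && _); apply/forallP/forall_inP => [h A _|h A]; first by rewrite f_ge0.
rewrite -f_ge0; apply: le_trans (f_span y A); apply: le_trans (f_cyc y (span M A)).
exact/h/cyclic_flat_span_cyc.
Qed.

(** The identity of indicators holds at every single point [y], hence the identity of counts is
    exact for each [k]; points off the hyperplane contribute 0 to both sides. *)
Lemma card_rank_points :
  #|rank_points|%:Z =
  \sum_(F : anchored_chain M) chain_mu F * #|chain_points d k F|%:Z.
Proof.
have card_E : (1 < #|'I_n.+1|)%N by rewrite card_ord.
have cardz (S : {set {ffun 'I_n.+1 -> 'I_k.+1}}) : #|S|%:Z = \sum_y (y \in S)%:R.
  rewrite -natz -sum1_card big_mkcond natr_sum; apply: eq_bigr => y _.
  by case: (y \in S).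
rewrite cardz; under [RHS]eq_bigr => F _ do rewrite cardz mulr_sumr.
rewrite exchange_big; apply: eq_bigr => y _ /=; rewrite rank_pointsE.
have [sy|nsy] := boolP (\sum_i y i == d.+1 * k)%N; last first.
  by rewrite big1 // => F _; rewrite inE (negbTE nsy) mulr0.
rewrite -(sum_chain_mu conM card_E (f_submod y) (f_span y) (f_cyc y)).
- rewrite [LHS]big_mkcond; apply: eq_bigr => F _; rewrite inE sy /=.
  have -> : [forall A in chain_set F, 0 <= f y A] =
      [forall A in chain_set F, \sum_(i in A) y i <= rank M A * k]%N.
    by apply: eq_forallb_in => A _; rewrite f_ge0.
  by case: ifP; rewrite ?mulr1 ?mulr0.
- by rewrite f_ge0 big_set0.
- by rewrite f_ge0 -[rank M _]/(matroid_rank M) M_rank -(eqP sy) leq_eqVlt;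
    apply/orP; left; apply/eqP; apply: eq_bigl => i; rewrite inE.
Qed.

End FlatPoints.

From mathcomp Require Import all_classical all_reals all_analysis.
From mathcomp Require Import measurable_realfun.

(** * Lebesgue volume and grid points *)

Local Open Scope classical_set_scope.

Section LebesgueVolumeMeasure.

Variable R : realType.
Local Notation leb := (@lebesgue_measure R).

Definition cube (K : nat) (m : nat) : set (m.-tuple R) :=
  [set t | forall i, - K%:R <= tnth t i <= K%:R].

Lemma measurable_cube K m : measurable (@cube K m).
Proof.
have -> : @cube K m = \bigcap_(i in [set: 'I_m])
    ((fun t : m.-tuple R => tnth t i) @^-1` `[- K%:R, K%:R]).
  by apply/seteqP; split => [t ht i _|t ht i]; have := ht i; rewrite /= in_itv //=; apply.
apply: fin_bigcap_measurable => [|i _]; first exact: finite_finset.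
by rewrite -[X in measurable X]setTI; exact: measurable_tnth.
Qed.

Definition tcons m (p : R * m.-tuple R) : m.+1.-tuple R := [tuple of p.1 :: p.2].

Lemma measurable_tcons m : measurable_fun [set: R * m.-tuple R] (@tcons m).
Proof. exact: (measurable_cons measurable_fst measurable_snd). Qed.

Lemma measurable_preimage_tcons m (A : set (m.+1.-tuple R)) :
  measurable A -> measurable (@tcons m @^-1` A).
Proof. by move=> mA; rewrite -[X in measurable X]setTI; exact: measurable_tcons. Qed.

Lemma xsection_tcons m (A : set (m.+1.-tuple R)) x :
  xsection (@tcons m @^-1` A) x = [set t : m.-tuple R | A [tuple of x :: t]].
Proof. by rewrite xsectionE. Qed.

Lemma preimage_tcons_cube K m :
  @tcons m @^-1` (@cube K m.+1) = `[- K%:R, K%:R]%classic `*` @cube K m.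
Proof.
apply/seteqP; split => [[x t] /= ht|[x t] [/= xK tK] i].
  split=> [|i /=]; first by have := ht ord0; rewrite /= in_itv.
  by have := ht (lift ord0 i); rewrite /tcons tnthS.
case: (unliftP ord0 i) => [j ->|->]; first by rewrite tnthS; exact: tK.
by rewrite /=; move: xK; rewrite in_itv.
Qed.

Section PushCons.

Variables (m : nat) (nu : {sigma_finite_measure set (m.-tuple R) -> \bar R}).
Hypothesis nu_cube : forall K, (nu (@cube K m) < +oo)%E.

Definition push : set (m.+1.-tuple R) -> \bar R := pushforward (leb \x nu)%E (@tcons m).

Let push0 : push set0 = 0%E.
Proof. by rewrite /push /pushforward preimage_set0 measure0. Qed.

Let push_ge0 A : (0 <= push A)%E.
Proof. by rewrite /push /pushforward. Qed.

Let push_sigma_additive : semi_sigma_additive push.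
Proof.
move=> F mF tF mUF; rewrite /push /pushforward preimage_bigcup.
apply: measure_semi_sigma_additive.
- by move=> i; exact: measurable_preimage_tcons.
- apply/trivIsetP => /= i j _ _ ij; rewrite -preimage_setI.
  by move/trivIsetP : tF => /(_ _ _ _ _ ij) ->//; rewrite preimage_set0.
- rewrite -preimage_bigcup; exact: measurable_preimage_tcons.
Qed.

HB.instance Definition _ := isMeasure.Build _ _ _ push push0 push_ge0 push_sigma_additive.

Let push_cube K : (push (@cube K m.+1) < +oo)%E.
Proof.
rewrite /push /pushforward preimage_tcons_cube product_measure1E //; last exact: measurable_cube.
apply: lte_mul_pinfty => //.
suff : leb `[- K%:R, K%:R] \is a fin_num by [].
by rewrite lebesgue_measure_itv /=; case: ifP.
Qed.

Let push_sigma_finite : sigma_finite setT push.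
Proof.
exists (fun K => @cube K m.+1) => [|K]; last by split; [exact: measurable_cube|exact: push_cube].
apply/seteqP; split=> // t _.
pose S := \sum_i `|tnth t i|; exists (Num.truncn S).+1 => // i.
have leS : `|tnth t i| <= S by rewrite /S (bigD1 i) //= lerDl sumr_ge0.
have : S < (Num.truncn S).+1%:R by rewrite truncnS_gt.
by rewrite -ler_norml => /ltW; apply: le_trans.
Qed.

HB.instance Definition _ := Measure_isSigmaFinite.Build _ _ _ push push_sigma_finite.

Lemma push_cons_measure : exists nu' : {sigma_finite_measure set (m.+1.-tuple R) -> \bar R},
  (forall A, nu' A = (leb \x nu)%E (@tcons m @^-1` A)) /\ forall K, (nu' (@cube K m.+1) < +oo)%E.
Proof.
pose nu' : {sigma_finite_measure set (m.+1.-tuple R) -> \bar R} := push.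
by exists nu'; split=> // K; exact: push_cube.
Qed.

End PushCons.

(** Tonelli speaks of measures, while [lebesgue_volume] is a recursively defined function on all
    sets. On measurable sets it agrees with the product measure pushed forward along [tcons];
    finiteness on cubes is carried along for sigma-finiteness and for the error terms. *)
Lemma lebesgue_volume_measure m :
  exists nu : {sigma_finite_measure set (m.-tuple R) -> \bar R},
    (forall A, measurable A -> lebesgue_volume A = nu A) /\
    forall K, (nu (@cube K m) < +oo)%E.
Proof.
elim: m => [|m [nu [volE nu_cube]]].
  exists (\d_([tuple] : 0.-tuple R)); split=> // K.
  by rewrite /= /dirac ltry.
have [nu' [nu'E nu'_cube]] := push_cons_measure nu_cube.
exists nu'; split=> // A mA; rewrite nu'E /=; apply: eq_integral => x _ /=.
rewrite volE -xsection_tcons //.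
by apply: measurable_xsection; exact: measurable_preimage_tcons.
Qed.

End LebesgueVolumeMeasure.

Arguments cube {R} K {m}.

(** * Grid points in an interval *)

Section GridInterval.

Variables (R : realType) (K k : nat).
Hypothesis k_gt0 : (0 < k)%N.
Local Notation leb := (@lebesgue_measure R).

Definition grid_size : nat := (2 * K * k).+1.

(* The points of [k^-1 Z] in [[-K, K]], in increasing order. *)
Definition grid (i : nat) : R := (i%:R - (K * k)%:R) / k%:R.

Let kR0 : 0 < k%:R :> R.
Proof. by rewrite ltr0n. Qed.

Lemma grid_diff i j : grid j - grid i = (j%:R - i%:R) / k%:R.
Proof. by rewrite /grid -mulrBl; congr (_ / _); ring. Qed.

Lemma grid_le i j : (i <= j)%N -> grid i <= grid j.
Proof. by move=> ij; rewrite -subr_ge0 grid_diff divr_ge0 // subr_ge0 ler_nat. Qed.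

Lemma grid_cell x : - K%:R <= x <= K%:R ->
  exists2 i : 'I_grid_size, grid i <= x & x < grid i.+1.
Proof.
move=> /andP[Kx xK]; pose s := (x + K%:R) * k%:R.
have s0 : 0 <= s by rewrite mulr_ge0 //; lra.
have /andP[le_s lt_s] := truncn_itv s0.
have lt_i : (Num.truncn s < grid_size)%N.
  rewrite ltnS -(ler_nat R); apply: le_trans le_s _; rewrite /s !natrM ler_pM2r //; lra.
exists (Ordinal lt_i) => /=.
  by rewrite /grid ler_pdivrMr // natrM; move: le_s; rewrite /s; lra.
by rewrite /grid ltr_pdivlMr // natrM; move: lt_s; rewrite /s; lra.
Qed.

Variable I : set R.
Hypotheses (mI : measurable I) (I_sub : forall x, I x -> - K%:R <= x <= K%:R).
Hypothesis I_conv : forall x y z, I x -> I y -> x <= z <= y -> I z.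

Let J : {set 'I_grid_size} := [set i : 'I_grid_size | grid i \in I]%SET.

Let sum_J : \sum_(i < grid_size) \1_I (grid i) = #|J|%:R :> R.
Proof.
rewrite -sum1_card natr_sum [RHS]big_mkcond; apply: eq_bigr => i _.
by rewrite indicE !inE; case: (_ \in _).
Qed.

(** If the cells met by [I] range from [p] to [q], its length is at most [(q + 1 - p) / k]; by
    convexity it contains the grid points [p + 1, ..., q]. *)
Lemma grid_interval_le : (leb I <= (k%:R^-1 * \sum_(i < grid_size) \1_I (grid i) + k%:R^-1)%:E)%E.
Proof.
have rhs0 : 0 <= k%:R^-1 * \sum_(i < grid_size) \1_I (grid i) + k%:R^-1 :> R.
  by rewrite addr_ge0 ?mulr_ge0 ?invr_ge0 ?ler0n // sumr_ge0.
have [[x0 Ix0]|/asboolPn/forallp_asboolPn I0] := pselect (exists x, I x); last first.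
  have I00 : I = set0 by apply/seteqP; split=> // x /I0.
  by rewrite [X in leb X]I00 measure0 lee_fin.
pose meet (i : 'I_grid_size) := `[<exists2 x, I x & grid i <= x < grid i.+1>].
have meetP x : I x -> exists2 i, meet i & grid i <= x < grid i.+1.
  move=> Ix; have [i le1 lt1] := grid_cell (I_sub Ix); exists i; last by rewrite le1.
  by apply/asboolP; exists x; rewrite // le1.
have [i0 mi0 _] := meetP _ Ix0.
case: (@arg_minnP _ i0 meet (fun i => i : nat) mi0) => p /asboolP[xp Ixp /andP[_ xp_lt]] minp.
case: (@arg_maxnP _ i0 meet (fun i => i : nat) mi0) => q /asboolP[xq Ixq /andP[xq_ge _]] maxq.
have pq : (p <= q)%N := leq_trans (minp _ mi0) (maxq _ mi0).
have sub : I `<=` `[grid p, grid q.+1].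
  move=> x Ix; have [i mi /andP[le1 lt1]] := meetP _ Ix; rewrite /= in_itv /=.
  rewrite (le_trans (grid_le (minp _ mi)) le1) (le_trans (ltW lt1)) //.
  by apply: grid_le; exact: maxq.
have le1 : (leb I <= ((q.+1%:R - p%:R) / k%:R)%:E)%E.
  have : (leb I <= leb `[grid p, grid q.+1])%E by apply: le_measure; rewrite ?inE.
  move=> /le_trans; apply.
  rewrite lebesgue_measure_itv /= -grid_diff; case: ifP => // _.
  by rewrite lee_fin subr_ge0 grid_le // ltnW.
apply: le_trans le1 _; rewrite lee_fin sum_J mulrC -[X in _ <= _ + X]mulr1 -mulrDr ler_pM2l ?invr_gt0 //.
suff : (q - p <= #|J|)%N by rewrite -(ler_nat R) natrB // -natr1; lra.
have ltj (j : 'I_(q - p)) : (p.+1 + j < grid_size)%N.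
  by have := ltn_ord j; have := ltn_ord q; lia.
have hI : injective (fun j => Ordinal (ltj j)).
  by move=> j j' /(congr1 val) /= /addnI /val_inj.
rewrite -[X in (X <= _)%N]card_ord -(card_imset _ hI); apply: subset_leq_card.
apply/fintype.subsetP => _ /imsetP[j _ ->]; rewrite !inE; apply: (I_conv Ixp Ixq).
rewrite (le_trans (ltW xp_lt)) ?(le_trans _ xq_ge) ?grid_le //=; last by lia.
by have := ltn_ord j; lia.
Qed.

(** If the grid points in [I] range from [p] to [q], there are at most [q - p + 1] of them, and by
    convexity [I] contains an interval of length [(q - p) / k]. *)
Lemma grid_interval_ge : ((k%:R^-1 * \sum_(i < grid_size) \1_I (grid i))%:E <= leb I + k%:R^-1%:E)%E.
Proof.
rewrite sum_J; have [J0|/set0Pn[i0 i0J]] := eqVneq J finset.set0.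
  by rewrite J0 cards0 mulr0 adde_ge0 // lee_fin invr_ge0.
case: (@arg_minnP _ i0 (mem J) (fun i => i : nat) i0J) => p pJ minp.
case: (@arg_maxnP _ i0 (mem J) (fun i => i : nat) i0J) => q qJ maxq.
have pq : (p <= q)%N := leq_trans (minp _ i0J) (maxq _ i0J).
have sub : `[grid p, grid q] `<=` I.
  move=> x; rewrite /= in_itv /=; apply: I_conv; first by move: pJ; rewrite !inE.
  by move: qJ; rewrite !inE.
have le1 : (((q%:R - p%:R) / k%:R)%:E <= leb I)%E.
  have : (leb `[grid p, grid q] <= leb I)%E by apply: le_measure; rewrite ?inE.
  apply: le_trans.
  rewrite lebesgue_measure_itv /= lte_fin -grid_diff; case: ltP => // le.
  by rewrite lee_fin subr_le0.
apply: le_trans (leeD le1 (lexx _)); rewrite -EFinD lee_fin mulrC -[X in _ + X]mul1r -mulrDl.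
rewrite ler_pM2r ?invr_gt0 //.
suff : (#|J| <= (q - p).+1)%N by rewrite -(ler_nat R) -natr1 natrB.
pose h (j : 'I_(q - p).+1) : 'I_grid_size := insubd p (p + j)%N.
rewrite -[X in (_ <= X)%N]card_ord; apply: leq_trans (leq_imset_card h predT).
apply: subset_leq_card; apply/fintype.subsetP => i iJ; apply/imsetP.
have pi : (p <= i)%N := minp _ iJ; have iq : (i <= q)%N := maxq _ iJ.
have ltj : (i - p < (q - p).+1)%N by lia.
exists (Ordinal ltj) => //; apply: val_inj; rewrite /h val_insubd /= subnKC //.
by rewrite ltn_ord.
Qed.

End GridInterval.

(** * Volume of a polyhedron from its grid points *)

Section GridVolume.

Variable R : realType.
Local Notation leb := (@lebesgue_measure R).

(** This class is closed under fixing the first coordinate, with the same [T], and its sections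
    along lines are convex; the induction on the dimension rests on both. *)
Definition polyhedron (m : nat) (T : finType) (c : T -> 'I_m -> R) (a : T -> R) :
    set (m.-tuple R) :=
  [set t | forall j, \sum_i c j i * tnth t i <= a j].

Lemma measurable_polyhedron m (T : finType) (c : T -> 'I_m -> R) (a : T -> R) :
  measurable (polyhedron c a).
Proof.
have -> : polyhedron c a = \bigcap_(j in [set: T])
    ((fun t : m.-tuple R => \sum_i c j i * tnth t i) @^-1` `]-oo, a j]).
  by apply/seteqP; split => [t ht j _|t ht j]; have := ht j; rewrite /= in_itv //=; apply.
apply: fin_bigcap_measurable => [|j _]; first exact: finite_finset.
rewrite -[X in measurable X]setTI.
have mf : measurable_fun setT (fun t : m.-tuple R => \sum_i c j i * tnth t i).
  by apply: measurable_sum => i; apply: measurable_funM => //; exact: measurable_tnth.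
by apply: mf => //; exact: measurable_itv.
Qed.

Lemma sum_tcons m (c : 'I_m.+1 -> R) (x : R) (t : m.-tuple R) :
  \sum_i c i * tnth [tuple of x :: t] i = c ord0 * x + \sum_i c (lift ord0 i) * tnth t i.
Proof. by rewrite big_ord_recl; congr (_ + _); apply: eq_bigr => i _; rewrite tnthS. Qed.

Lemma section_polyhedron m (T : finType) (c : T -> 'I_m.+1 -> R) (a : T -> R) (x : R) :
  [set t : m.-tuple R | polyhedron c a [tuple of x :: t]] =
  polyhedron (fun j i => c j (lift ord0 i)) (fun j => a j - c j ord0 * x).
Proof. by apply/seteqP; split => t h j; have := h j; rewrite sum_tcons lerBrDl. Qed.

Lemma polyhedron_conv m (T : finType) (c : T -> 'I_m.+1 -> R) (a : T -> R)
    (t : m.-tuple R) x y z : polyhedron c a [tuple of x :: t] ->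
  polyhedron c a [tuple of y :: t] -> x <= z <= y -> polyhedron c a [tuple of z :: t].
Proof.
move=> hx hy /andP[xz zy] j; have := hx j; have := hy j; rewrite !sum_tcons.
have [c0|c0] := leP 0 (c j ord0).
  by have := ler_wpM2l c0 zy; lra.
by have := ler_wnM2l (ltW c0) xz; lra.
Qed.

Fixpoint grid_count (K k m : nat) : set (m.-tuple R) -> nat :=
  match m with
  | 0 => fun A => `[< A [tuple] >] : nat
  | m'.+1 => fun A => (\sum_(i < grid_size K k)
      grid_count K k [set t : m'.-tuple R | A [tuple of grid R K k i :: t]])%N
  end.

Lemma integral_sum_indic d (T : measurableType d) (nu : {measure set T -> \bar R})
    (L : nat) (A : 'I_L -> set T) (c : R) : 0 <= c -> (forall i, measurable (A i)) ->
  (\int[nu]_t (c * \sum_(i < L) \1_(A i) t)%:E = c%:E * \sum_(i < L) nu (A i))%E.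
Proof.
move=> c0 mA; under eq_integral do rewrite EFinM -sumEFin.
rewrite ge0_integralZl //=; first last.
- by move=> t _; apply: sume_ge0 => i _; rewrite lee_fin.
- apply: emeasurable_sum => i; apply/measurable_EFinP; exact: measurable_indic.
congr (_ * _)%E; rewrite ge0_integral_sum //.
- by apply: eq_bigr => i _; rewrite integral_indic // setIT.
- by move=> i; apply/measurable_EFinP; exact: measurable_indic.
Qed.

(** The definition of [lebesgue_volume] integrates the head coordinate last; here it comes first, by
    uniqueness of the product measure. *)
Lemma volume_fubini m (nu : {sigma_finite_measure set (m.-tuple R) -> \bar R})
    (A : set (m.+1.-tuple R)) :
    (forall B, measurable B -> lebesgue_volume B = nu B) -> measurable A ->
  lebesgue_volume A = (\int[nu]_t leb [set x | A [tuple of x :: t]])%E.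
Proof.
move=> volE mA; have mA' := measurable_preimage_tcons mA.
transitivity ((leb \x nu)%E (@tcons R m @^-1` A)).
  rewrite /=; apply: eq_integral => x _; rewrite volE -xsection_tcons //.
  exact: measurable_xsection.
transitivity ((leb \x^ nu)%E (@tcons R m @^-1` A)).
  by apply: product_measure_unique => //= ? ? ? ?; rewrite product_measure2E.
by apply: eq_integral => t _ /=; rewrite ysectionE.
Qed.

(* By Tonelli one coordinate can be integrated first; its fibres are intervals,
   where sum and integral differ by at most one grid step. *)
Lemma polyhedron_volume (K m : nat) : exists2 C : R, 0 <= C & forall (k : nat) (T : finType)
    (c : T -> 'I_m -> R) (a : T -> R), (0 < k)%N -> polyhedron c a `<=` cube K ->
  (lebesgue_volume (polyhedron c a) <=
     ((grid_count K k (polyhedron c a))%:R / k%:R ^+ m + C / k%:R)%:E)%E /\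
  (((grid_count K k (polyhedron c a))%:R / k%:R ^+ m)%:E <=
     lebesgue_volume (polyhedron c a) + (C / k%:R)%:E)%E.
Proof.
elim: m => [|m [C C0 IH]].
  exists 0 => // k T c a k0 _; rewrite mul0r addr0 expr0 divr1 adde0 /=.
  by rewrite diracE; case: asboolP => h; [rewrite mem_set|rewrite memNset].
have [nu [volE nu_cube]] := lebesgue_volume_measure R m.
(* There are [2 * K * k + 1] slices, each with error [C / k] and weight [1 / k], which gives the
   first summand. The second is the error [1 / k] of each fibre, integrated over the cube. *)
exists ((2 * K + 1)%N%:R * C + fine (nu (cube K))) => [|k T c a k0 sub].
  by rewrite addr_ge0 ?mulr_ge0 ?fine_ge0.
set A := polyhedron c a; have mA : measurable A := measurable_polyhedron c a.
pose s (i : 'I_(grid_size K k)) := [set t : m.-tuple R | A [tuple of grid R K k i :: t]].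
have kR : 0 < k%:R :> R by rewrite ltr0n.
have ms i : measurable (s i) by rewrite /s section_polyhedron; exact: measurable_polyhedron.
have fib (t : m.-tuple R) : measurable [set x : R | A [tuple of x :: t]].
  have := measurable_ysection t (measurable_preimage_tcons mA).
  by rewrite ysectionE.
have mfib : measurable_fun setT (fun t : m.-tuple R => leb [set x : R | A [tuple of x :: t]]).
  have := measurable_fun_ysection leb (measurable_preimage_tcons mA).
  by congr measurable_fun; apply/funext => t /=; rewrite ysectionE.
have indE (t : m.-tuple R) : \sum_(i < grid_size K k) \1_[set x : R | A [tuple of x :: t]] (grid R K k i) =
    \sum_(i < grid_size K k) \1_(s i) t by [].
have cubeE (t : m.-tuple R) x : A [tuple of x :: t] -> - K%:R <= x <= K%:R /\ cube K t.
  move=> /sub h; split; first exact: (h ord0).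
  by move=> i; have := h (lift ord0 i); rewrite tnthS.
have mC := @measurable_cube R K m.
have [P1 P2] : (lebesgue_volume A <= k%:R^-1%:E * \sum_i nu (s i) + k%:R^-1%:E * nu (cube K))%E /\
    (k%:R^-1%:E * \sum_i nu (s i) <= lebesgue_volume A + k%:R^-1%:E * nu (cube K))%E.
  have kV0 : 0 <= k%:R^-1 :> R by rewrite invr_ge0.
  have int_cube : (\int[nu]_t (k%:R^-1 * \1_(cube K) t)%:E = k%:R^-1%:E * nu (cube K))%E.
    have := @integral_sum_indic _ _ nu 1 (fun=> cube K) _ kV0 (fun=> mC).
    by under eq_integral do rewrite big_ord1; rewrite big_ord1.
  have msum : measurable_fun setT (fun t =>
      (k%:R^-1 * \sum_(i < grid_size K k) \1_(s i) t : R)%:E).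
    apply/measurable_EFinP; apply: measurable_funM => //; apply: measurable_sum => i.
    exact: measurable_indic.
  have mcub : measurable_fun setT (fun t : m.-tuple R => (k%:R^-1 * \1_(cube K) t : R)%:E).
    by apply/measurable_EFinP; apply: measurable_funM => //; exact: measurable_indic.
  have sum0 t : 0 <= k%:R^-1 * \sum_(i < grid_size K k) \1_(s i) t :> R.
    by rewrite mulr_ge0 // sumr_ge0.
  have cub0 (t : m.-tuple R) : 0 <= k%:R^-1 * \1_(cube K) t :> R by rewrite mulr_ge0.
  rewrite (volume_fubini volE mA) -int_cube -integral_sum_indic //.
  have conv (t : m.-tuple R) x y z : A [tuple of x :: t] -> A [tuple of y :: t] -> x <= z <= y ->
      A [tuple of z :: t] by exact: polyhedron_conv.
  have empty (t : m.-tuple R) : ~ cube K t -> [set x : R | A [tuple of x :: t]] = set0.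
    by move=> nt; apply/seteqP; split=> // x /cubeE[].
  split; rewrite -ge0_integralD //.
  - apply: ge0_le_integral => //; first exact: emeasurable_funD.
    move=> t _; rewrite -indE; have [ct|nct] := pselect (cube K t).
      rewrite indicE mem_set // mulr1 -EFinD; apply: grid_interval_le => //.
      - by move=> x /cubeE[].
      - exact: conv.
    by rewrite empty // measure0 -EFinD lee_fin addr_ge0 // mulr_ge0 ?sumr_ge0.
  - by move=> t _; rewrite lee_fin.
  - apply: ge0_le_integral => //; first by move=> t _; rewrite lee_fin.
      exact: emeasurable_funD.
    move=> t _; rewrite -indE; have [ct|nct] := pselect (cube K t).
      rewrite [\1_(cube K) t]indicE mem_set // mulr1; apply: grid_interval_ge => //.
      exact: conv.
    rewrite empty // measure0 add0e lee_fin big1 ?mulr0 // => i _.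
    by rewrite indicE in_set0.
have cubeF : nu (cube K) = (fine (nu (cube K)))%:E by rewrite fineK // ge0_fin_numE // nu_cube.
have sE i : s i = polyhedron (fun j l => c j (lift ord0 l)) (fun j => a j - c j ord0 * grid R K k i).
  exact: section_polyhedron.
have s_cube i : s i `<=` cube K by move=> t /cubeE[].
pose r i := fine (nu (s i)).
have rE i : nu (s i) = (r i)%:E.
  rewrite fineK // ge0_fin_numE //; apply: le_lt_trans (nu_cube K).
  by apply: le_measure; rewrite ?inE //; exact: s_cube.
pose N i := (grid_count K k (s i))%:R / k%:R ^+ m : R.
have [rN Nr] : (forall i, r i <= N i + C / k%:R) /\ forall i, N i <= r i + C / k%:R.
  have H i : r i <= N i + C / k%:R /\ N i <= r i + C / k%:R.
    have := s_cube i; rewrite sE => sub_i; have [] := IH k T _ _ k0 sub_i.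
    by rewrite -!(sE i) volE // rE -EFinD !lee_fin; split.
  by split=> i; case: (H i).
have countE : (grid_count K k A)%:R / k%:R ^+ m.+1 = k%:R^-1 * \sum_i N i.
  by rewrite /= natr_sum -mulr_suml mulrC mulrA mulrC exprS invfM mulrA [_ * k%:R^-1]mulrC -mulrA.
have sumC : k%:R^-1 * \sum_(i < grid_size K k) (C / k%:R) <= (2 * K + 1)%N%:R * C / k%:R.
  rewrite sumr_const card_ord -[X in _ * X <= _]mulr_natl !mulrA ler_pM2r ?invr_gt0 // ler_wpM2r //.
  rewrite ler_pdivrMl // -natrM ler_nat /grid_size; lia.
have F0 : (2 * K + 1)%N%:R * C / k%:R + k%:R^-1 * fine (nu (cube K)) =
    ((2 * K + 1)%N%:R * C + fine (nu (cube K))) / k%:R by rewrite mulrDl [fine _ / _]mulrC.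
move: P1 P2; under eq_bigr do rewrite rE; rewrite sumEFin cubeF -!EFinM -EFinD => P1 P2.
rewrite countE -F0; split.
  apply: le_trans P1 _; rewrite lee_fin addrA lerD2r.
  apply: le_trans (lerD (lexx _) sumC); rewrite -mulrDr -big_split ler_pM2l ?invr_gt0 //.
  by apply: ler_sum => i _; exact: rN.
rewrite EFinD addeCA addeC; apply: le_trans (leeD P2 (lexx _)).
rewrite -EFinD lee_fin; apply: le_trans (lerD (lexx _) sumC).
rewrite -mulrDr -big_split ler_pM2l ?invr_gt0 //.
by apply: ler_sum => i _; exact: Nr.
Qed.

End GridVolume.

(** * Lattice charts of the base polytope *)

Lemma grid_count_card (R : realType) (K k m : nat) (A : set (m.-tuple R)) :
  grid_count K k A =
  #|[set u : m.-tuple 'I_(grid_size K k) | `[< A [tuple of map (fun i : 'I_(grid_size K k) => grid R K k i) u] >]]%SET|.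
Proof.
elim: m A => [|m IH] A.
  rewrite /= -sum1_card big_mkcond (big_pred1 [tuple]) => [|u]; last by apply/esym/eqP; rewrite [u]tuple0.
  rewrite inE; congr (nat_of_bool _); congr asbool; congr A.
  by apply: val_inj.
rewrite -sum1_card (partition_big (fun u => thead u) predT) //=; apply: eq_bigr => i _.
rewrite IH sum1_card.
have cI : injective (fun u : m.-tuple 'I_(grid_size K k) => [tuple of i :: u]).
  by move=> u v /(congr1 val) [] /val_inj.
rewrite -(card_imset _ cI); apply: eq_card => u; rewrite -[in RHS]topredE /= inE.
apply/imsetP/andP => [[v]|[/asboolP Au /eqP ui]].
  rewrite inE => /asboolP Av ->; rewrite theadE eqxx; split=> //; apply/asboolP.
  by move: Av; congr A; apply: val_inj.
case/tupleP: u Au ui => j v; rewrite theadE => Av ji; exists v; last by rewrite ji.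
rewrite inE; apply/asboolP; move: Av; congr A; apply: val_inj.
by rewrite /= ji.
Qed.

(** Grid points and integer points are matched by an equation between real vectors; a relation
    spares explicit maps between the two finite types. *)
Lemma card_eq_rel (T1 T2 : finType) (S1 : {set T1}) (S2 : {set T2}) (r : T1 -> T2 -> Prop) :
    (forall x, x \in S1 -> exists2 y, y \in S2 & r x y) ->
    (forall y, y \in S2 -> exists2 x, x \in S1 & r x y) ->
    (forall x x' y, r x y -> r x' y -> x = x') ->
    (forall x y y', r x y -> r x y' -> y = y') ->
  #|S1| = #|S2|.
Proof.
have leq (U1 U2 : finType) (V1 : {set U1}) (V2 : {set U2}) (s : U1 -> U2 -> Prop) :
    (forall x, x \in V1 -> exists2 y, y \in V2 & s x y) ->
    (forall x x' y, s x y -> s x' y -> x = x') -> (#|V1| <= #|V2|)%N.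
  move=> tot inj; pose h x := [pick y in V2 | `[< s x y >]].
  have hP x : x \in V1 -> exists2 y, y \in V2 & h x = Some y /\ s x y.
    move=> /tot[y yV sy]; rewrite /h; case: pickP => [z /andP[zV /asboolP sz]|/(_ y)].
      by exists z.
    by rewrite yV => /asboolP.
  have hI : {in V1 &, injective h}.
    move=> x x' /hP[y _ [-> sy]] /hP[y' _ [-> sy']] [e].
    by apply: inj sy _; rewrite e.
  rewrite -(card_in_imset hI) -(card_imset V2 Some_inj); apply: subset_leq_card.
  by apply/fintype.subsetP => _ /imsetP[x /hP[y yV [-> _]] ->]; apply: imset_f.
move=> tot1 tot2 inj1 inj2; apply/eqP; rewrite eqn_leq (leq _ _ _ _ r) //=.
apply: (leq _ _ _ _ (fun y x => r x y)) => // x x' y; exact: inj2.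
Qed.

(** * Inequalities and affine hull of the base polytope *)

Section BasePolytope.

Variables (R : realType) (n : nat) (M : matroid 'I_n.+1).
Local Notation N := n.+1.
Local Notation P := (base_polytope R M).
Local Notation vertex B := (\sum_(i in B) delta_mx 0 i : 'rV[R]_N).

Lemma vertexE (B : {set 'I_N}) l : (vertex B) 0 l = (l \in B)%:R.
Proof.
rewrite summxE (eq_bigr (fun i => (i == l)%:R)) ?sum_pred1_set // => i _.
by rewrite mxE eqxx eq_sym.
Qed.

Lemma indicator_rank_polytope (B : {set 'I_N}) : B \in bases M ->
  in_rank_polytope M (indicator R B).
Proof.
move=> BM; have iB : indep M B by apply/indepP; exists B.
have sumE (A : {set 'I_N}) : \sum_(i in A) indicator R B i = #|A :&: B|%:R.
  under eq_bigr do rewrite ffunE.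
  rewrite -natr_sum -sum1_card big_mkcond [in RHS]big_mkcond; congr _%:R.
  by apply: eq_bigr => i _; rewrite inE; case: (i \in A); case: (i \in B).
split=> [i|A|]; first by rewrite ffunE.
  by rewrite sumE ler_nat rank_ge ?subsetIl // (indepS _ iB) ?subsetIr.
have := sumE [set: 'I_N]%SET; rewrite (eq_bigl xpredT) => [->|i]; last by rewrite inE.
rewrite finset.setTI; congr _%:R; apply/eqP; rewrite eqn_leq rank_ge ?finset.subsetT //=.
have [J [_ /indepP[D DM JD] <-]] := rank_basis M [set: 'I_N]%SET.
by rewrite (card_bases BM DM) subset_leq_card.
Qed.

Lemma conv_hull_rank_polytope (x : 'rV[R]_N) : P x -> in_rank_polytope M [ffun i => x 0 i].
Proof.
move=> [k [c [p [c0 c1 pB ->]]]].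
have pQ i : in_rank_polytope M [ffun l => p i 0 l].
  have [B BM ->] := pB i; have := indicator_rank_polytope BM; congr in_rank_polytope.
  by apply/ffunP => l; rewrite !ffunE vertexE.
have xE l : [ffun i => (\sum_i c i *: p i) 0 i] l = \sum_i c i * p i 0 l.
  by rewrite ffunE summxE; apply: eq_bigr => i _; rewrite mxE.
split=> [l|A|].
- rewrite xE; apply: sumr_ge0 => i _; rewrite mulr_ge0 //.
  by have [/(_ l)] := pQ i; rewrite ffunE.
- under eq_bigr do rewrite xE.
  rewrite exchange_big /= -[leRHS]mul1r -[X in X * _]c1 mulr_suml; apply: ler_sum => i _.
  rewrite -mulr_sumr ler_wpM2l //; have [_ /(_ A) + _] := pQ i; apply: le_trans.
  by rewrite [leRHS](eq_bigr (fun l => p i 0 l)) // => l _; rewrite ffunE.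
under eq_bigr do rewrite xE.
rewrite exchange_big /= -[RHS]mul1r -[X in X * _]c1 mulr_suml; apply: eq_bigr => i _.
rewrite -mulr_sumr; congr (_ * _); have [_ _ <-] := pQ i.
by apply: eq_bigr => l _; rewrite ffunE.
Qed.

Lemma conv_hull_convex m (A : set 'rV[R]_m) (x y : 'rV[R]_m) (t : R) : 0 <= t <= 1 ->
  conv_hull A x -> conv_hull A y -> conv_hull A (t *: x + (1 - t) *: y).
Proof.
move=> /andP[t0 t1] [k [c [p [c0 c1 pA ->]]]] [k' [c' [p' [c0' c1' pA' ->]]]].
exists (k + k')%N, (fun i => match fintype.split i with inl j => t * c j | inr j => (1 - t) * c' j end).
exists (fun i => match fintype.split i with inl j => p j | inr j => p' j end); split.
- by move=> i; case: splitP => j _; rewrite mulr_ge0 // subr_ge0.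
- rewrite big_split_ord /=; under eq_bigr do rewrite -/(unsplit (inl _)) unsplitK.
  under [X in _ + X]eq_bigr do rewrite -/(unsplit (inr _)) unsplitK.
  by rewrite -!mulr_sumr c1 c1' !mulr1 addrC subrK.
- by move=> i; case: splitP.
rewrite [RHS]big_split_ord /= !scaler_sumr; congr (_ + _); apply: eq_bigr => i _.
- by rewrite -/(unsplit (inl _)) unsplitK scalerA.
- by rewrite -/(unsplit (inr _)) unsplitK scalerA.
Qed.

(** The harder inclusion is [rank_polytope_ind] for membership in the hull, which contains the
    vertices and is convex. *)
Lemma base_polytopeP (x : 'rV[R]_N) : P x <-> in_rank_polytope M [ffun i => x 0 i].
Proof.
split=> [|xQ]; first exact: conv_hull_rank_polytope.
have -> : x = \row_l [ffun i => x 0 i] l by apply/rowP => l; rewrite mxE ffunE.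
apply: (rank_polytope_ind (C := fun y : {ffun 'I_N -> R} => P (\row_l y l))) xQ => [B BM|y z t t01 Py Pz].
  exists 1%N, (fun=> 1), (fun=> vertex B); split=> //; try by rewrite big_ord1.
    by move=> _; exists B.
  by rewrite big_ord1 scale1r; apply/rowP => l; rewrite mxE vertexE ffunE.
have := conv_hull_convex t01 Py Pz; congr (conv_hull _).
by apply/rowP => l; rewrite !mxE ffunE.
Qed.

Lemma vertex_base_polytope B : B \in bases M -> P (vertex B).
Proof.
move=> BM; apply/base_polytopeP; have := indicator_rank_polytope BM; congr in_rank_polytope.
by apply/ffunP => l; rewrite !ffunE vertexE.
Qed.

Lemma aff_hull_step m (A : set 'rV[R]_m) (x p q : 'rV[R]_m) (t : R) :
  aff_hull A x -> A p -> A q -> aff_hull A (x + t *: (p - q)).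
Proof.
move=> [k [c [r [c1 rA ->]]]] Ap Aq.
exists (k + 2)%N, (fun i => match fintype.split i with inl j => c j | inr j => if j == ord0 then t else - t end).
exists (fun i => match fintype.split i with inl j => r j | inr j => if j == ord0 then p else q end); split.
- rewrite big_split_ord /=; under eq_bigr do rewrite -/(unsplit (inl _)) unsplitK.
  under [X in _ + X]eq_bigr do rewrite -/(unsplit (inr _)) unsplitK.
  by rewrite c1 !big_ord_recl big_ord0 /= addr0 subrr addr0.
- by move=> i; case: splitP => // j _; case: ifP.
rewrite [RHS]big_split_ord /=; congr (_ + _).
  by apply: eq_bigr => i _; rewrite -/(unsplit (inl _)) unsplitK.
under eq_bigr do rewrite -/(unsplit (inr _)) unsplitK.
by rewrite !big_ord_recl big_ord0 /= addr0 scalerBr scaleNr.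
Qed.

Lemma aff_hull_sub m (A : set 'rV[R]_m) : A `<=` aff_hull A.
Proof.
move=> x Ax; exists 1%N, (fun=> 1), (fun=> x); split=> //; first by rewrite big_ord1.
by rewrite big_ord1 scale1r.
Qed.

Hypothesis conM : matroid_connected M.

(** A vector of coordinate sum 0 is a combination of the [e_i - e_0], and by [connected_swap] each
    of these is a difference of two vertices. *)
Lemma aff_hull_base_polytope :
  aff_hull P = [set x : 'rV[R]_N | \sum_l x 0 l = (matroid_rank M)%:R].
Proof.
rewrite /matroid_rank; apply/seteqP; split=> [_ [k [c [p [c1 pP ->]]]] /=|x /= sx].
  under eq_bigr do rewrite summxE; rewrite exchange_big /= -[RHS]mul1r -[X in X * _]c1 mulr_suml.
  apply: eq_bigr => i _; have /base_polytopeP[_ _ <-] := pP i; rewrite mulr_sumr.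
  by apply: eq_bigr => l _; rewrite mxE ffunE.
have /set0Pn[B0 B0M] := bases_neq0 M.
pose w := x - vertex B0.
have sw : \sum_l w 0 l = 0.
  under eq_bigr do rewrite !mxE; rewrite sumrB sx.
  have /base_polytopeP[_ _] := vertex_base_polytope B0M.
  by under eq_bigr do rewrite ffunE; move=> ->; rewrite subrr.
have wE : w = \sum_(i <- enum 'I_N) w 0 i *: (delta_mx 0 i - delta_mx 0 ord0).
  rewrite big_enum /=; under [RHS]eq_bigr do rewrite scalerBr.
  by rewrite sumrB -scaler_suml sw scale0r subr0 -row_sum_delta.
have -> : x = vertex B0 + w by rewrite addrC subrK.
rewrite {}wE; elim: (enum _) => [|i s IH]; first by rewrite big_nil addr0; apply/aff_hull_sub/vertex_base_polytope.
rewrite big_cons addrCA addrC; have [->|i0] := eqVneq i ord0; first by rewrite subrr scaler0 addr0.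
have [B [BM iB oB B'M]] := connected_swap conM i0.
have -> : delta_mx 0 i - delta_mx 0 ord0 = vertex B - vertex (ord0 |: (B :\ i))%SET.
  apply/rowP => l; have subE (u v : 'rV[R]_N) : (u - v) 0 l = u 0 l - v 0 l by rewrite !mxE.
  rewrite !subE !vertexE !mxE !inE /=.
  have [->|li] := eqVneq l i; first by rewrite iB (negbTE i0).
  by have [->|lo] := eqVneq l ord0; rewrite ?(negbTE oB) ?subrr.
by apply: aff_hull_step => //; exact: vertex_base_polytope.
Qed.

End BasePolytope.

(** * Charts of the affine hull and their grid points *)

Section Charts.

Variables (R : realType) (n : nat) (M : matroid 'I_n.+1).
Hypothesis conM : matroid_connected M.
Local Notation N := n.+1.
Local Notation P := (base_polytope R M).
Local Notation vertex B := (\sum_(i in B) delta_mx 0 i : 'rV[R]_N).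

Definition std_frame : 'M[R]_(n, N) :=
  \matrix_(i, j) ((j == lift ord0 i)%:R - (j == ord0)%:R).

Lemma std_frameE (u : 'rV[R]_n) j :
  (u *m std_frame) 0 j = if unlift ord0 j is Some i then u 0 i else - \sum_i u 0 i.
Proof.
rewrite mxE; under eq_bigr do rewrite mxE; case: unliftP => [i ->|->].
  rewrite (bigD1 i) // eqxx (_ : (lift ord0 i == ord0) = false) // subr0 mulr1.
  rewrite big1 /= ?addr0 // => l li.
  by rewrite (inj_eq lift_inj) eq_sym (negbTE li) subr0 mulr0.
by rewrite -sumrN; apply: eq_bigr => i _; rewrite eqxx sub0r mulrN1.
Qed.

Lemma sum_std_frame (u : 'rV[R]_n) : \sum_j (u *m std_frame) 0 j = 0.
Proof.
rewrite big_ord_recl std_frameE unlift_none.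
by under [X in _ + X]eq_bigr do rewrite std_frameE liftK; rewrite addNr.
Qed.

Lemma std_frame_surj (v : 'rV[R]_N) : \sum_j v 0 j = 0 ->
  v = (\row_i v 0 (lift ord0 i)) *m std_frame.
Proof.
move=> sv; apply/rowP => j; rewrite std_frameE; case: unliftP => [i ->|->]; first by rewrite mxE.
under eq_bigr do rewrite mxE; move: sv; rewrite big_ord_recl => /eqP.
by rewrite addr_eq0 => /eqP.
Qed.

Lemma std_frame_free : row_free std_frame.
Proof.
apply/row_freeP; exists (\matrix_(j, i) (j == lift ord0 i)%:R); apply/matrixP => i l.
rewrite !mxE (bigD1 (lift ord0 l)) //= !mxE eqxx mulr1 (inj_eq lift_inj).
rewrite -[lift ord0 l == ord0]/false subr0 big1 ?addr0 1?eq_sym // => j jl.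
by rewrite !mxE (negbTE jl) mulr0.
Qed.

(** Any vertex serves as integral origin, and the rows [e_i - e_0] of [std_frame] form a lattice
    basis of the integral vectors of sum 0: the coordinates are read off by dropping entry 0. *)
Lemma exists_lattice_chart : exists b : 'rV[R]_N, lattice_chart P b std_frame.
Proof.
have /set0Pn[B BM] := bases_neq0 M; exists (vertex B).
have sB : \sum_l (vertex B) 0 l = (matroid_rank M)%:R.
  by have := aff_hull_sub (vertex_base_polytope R BM); rewrite aff_hull_base_polytope.
have addE (u v : 'rV[R]_N) l : (u + v) 0 l = u 0 l + v 0 l by rewrite mxE.
have surj (x : 'rV[R]_N) : \sum_l x 0 l = (matroid_rank M)%:R ->
    x = vertex B + (\row_i (x - vertex B) 0 (lift ord0 i)) *m std_frame.
  move=> sx; have sv : \sum_l (x - vertex B) 0 l = 0.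
    rewrite (eq_bigr (fun l => x 0 l - (vertex B) 0 l)) ?sumrB ?sx ?sB ?subrr // => l _.
    by rewrite addE [X in _ + X]mxE.
  by rewrite -(std_frame_surj sv) addrC subrK.
have intB l : (vertex B) 0 l \is a Num.int by rewrite vertexE; exact: natr_int.
split; first exact: std_frame_free.
- rewrite aff_hull_base_polytope //; apply/seteqP; split=> [x /surj ex|_ [u _ <-]] /=.
    by exists (\row_i (x - vertex B) 0 (lift ord0 i)).
  by under eq_bigr do rewrite addE; rewrite big_split /= sB sum_std_frame addr0.
- rewrite aff_hull_base_polytope //; apply/seteqP; split=> [x [/surj ex ix]|_ [u iu <-]].
    exists (\row_i (x - vertex B) 0 (lift ord0 i)) => // i; rewrite mxE addE [X in _ + X]mxE.
    by rewrite rpredB ?intB // ix.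
  split=> [|j]; first by rewrite /= ; under eq_bigr do rewrite addE;
    rewrite big_split /= sB sum_std_frame addr0.
  rewrite addE rpredD ?intB // std_frameE; case: unliftP => [i _|_]; first exact: iu.
  by rewrite rpredN rpred_sum.
Qed.

Section Chart.

Variables (m : nat) (b : 'rV[R]_N) (B : 'M[R]_(m, N)).
Hypothesis chartB : lattice_chart P b B.

Lemma chart_sum (u : 'rV[R]_m) : \sum_l (b + u *m B) 0 l = (matroid_rank M)%:R.
Proof.
have [_ affE _] := chartB.
have : aff_hull P (b + u *m B) by rewrite affE; exists u.
by rewrite aff_hull_base_polytope.
Qed.

Lemma chart_sum0 : \sum_l b 0 l = (matroid_rank M)%:R.
Proof. by have := chart_sum 0; rewrite mul0mx addr0. Qed.

Lemma chart_surj (x : 'rV[R]_N) : \sum_l x 0 l = (matroid_rank M)%:R ->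
  exists u, x = b + u *m B.
Proof.
move=> sx; have [_ affE _] := chartB.
have : aff_hull P x by rewrite aff_hull_base_polytope.
by rewrite affE => -[u _ <-]; exists u.
Qed.

Lemma chart_int (u : 'rV[R]_m) : (forall i, u 0 i \is a Num.int) ->
  forall l, (b + u *m B) 0 l \is a Num.int.
Proof.
move=> iu; have [_ _ intE] := chartB.
by have [] : (aff_hull P `&` @int_points R N) (b + u *m B) by rewrite intE; exists u.
Qed.

Lemma chart_int_inv (u : 'rV[R]_m) : (forall l, (b + u *m B) 0 l \is a Num.int) ->
  forall i, u 0 i \is a Num.int.
Proof.
move=> ix; have [freeB _ intE] := chartB.
have : (aff_hull P `&` @int_points R N) (b + u *m B).
  by split=> //; rewrite aff_hull_base_polytope //=; exact: chart_sum.
by rewrite intE => -[v iv] /addrI /(row_free_inj freeB) <-.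
Qed.

Lemma chart_b_int l : b 0 l \is a Num.int.
Proof.
have := @chart_int 0 _ l; rewrite mul0mx addr0; apply=> i.
by rewrite mxE rpred0.
Qed.

(** The rows of [B] and those of [std_frame] are two bases of the space of directions of the affine
    hull. *)
Lemma chart_dim : m = n.
Proof.
have [/eqP rB _ _] := chartB; have /eqP rS := std_frame_free.
apply/eqP; rewrite eqn_leq; apply/andP; split.
  suff : (\rank B <= \rank std_frame)%N by rewrite rB rS.
  apply: mxrankS; apply/row_subP => i.
  have -> : row i B = (b + delta_mx 0 i *m B) - b by rewrite addrC addKr rowE.
  rewrite [X in (X <= _)%MS]std_frame_surj ?submxMl //.
  have := chart_sum (delta_mx 0 i); have := chart_sum0.
  move=> s0 s1; rewrite (eq_bigr (fun l => (b + delta_mx 0 i *m B) 0 l - b 0 l)).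
    by rewrite sumrB s0 s1 subrr.
  by move=> l _; rewrite [LHS]mxE [X in _ + X]mxE.
suff : (\rank std_frame <= \rank B)%N by rewrite rB rS.
apply: mxrankS; apply/row_subP => i.
have s1 : \sum_l (b + row i std_frame) 0 l = (matroid_rank M)%:R.
  rewrite (eq_bigr (fun l => b 0 l + (row i std_frame) 0 l)); last by move=> l _; rewrite mxE.
  by rewrite big_split /= chart_sum0 rowE sum_std_frame addr0.
by have [u /addrI ->] := chart_surj s1; rewrite submxMl.
Qed.

End Chart.

Lemma rank_points_polytope (d k : nat) (y : {ffun 'I_N -> 'I_k.+1}) (x : 'rV[R]_N) :
    (0 < k)%N -> matroid_rank M = d.+1 -> (forall l, (y l)%:R = k%:R * x 0 l) ->
  y \in rank_points d k M <-> P x.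
Proof.
move=> k0 rM xy; have kR : 0 < k%:R :> R by rewrite ltr0n.
have sumE (Q : pred 'I_N) : (\sum_(l | Q l) y l)%N%:R = k%:R * \sum_(l | Q l) x 0 l.
  by rewrite natr_sum mulr_sumr; apply: eq_bigr => l _; rewrite xy.
rewrite base_polytopeP inE; split=> [/andP[/eqP sy /forallP sA]|[_ xA xT]].
  split=> [l|A|].
  - by rewrite ffunE -(pmulr_rge0 _ kR) -xy.
  - under eq_bigr do rewrite ffunE.
    by rewrite -(ler_pM2l kR) -sumE -natrM ler_nat mulnC.
  under eq_bigr do rewrite ffunE.
  apply: (mulfI (lt0r_neq0 kR)); rewrite -sumE sy -[rank M _]/(matroid_rank M) rM.
  by rewrite mulnC natrM.
apply/andP; split.
  rewrite -(eqr_nat R) sumE natrM mulrC -rM /matroid_rank -xT; apply/eqP; congr (_ * _).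
  by apply: eq_bigr => l _; rewrite ffunE.
apply/forallP => A; rewrite -(ler_nat R) sumE natrM mulrC ler_pM2r //.
by have := xA A; under eq_bigr do rewrite ffunE.
Qed.

Section ChartVolume.

Variables (d : nat) (b : 'rV[R]_N) (B : 'M[R]_(n, N)).
Hypotheses (chartB : lattice_chart P b B) (rM : matroid_rank M = d.+1).

Let chart_set : set (n.-tuple R) := [set t | P (b + (\row_i tnth t i) *m B)].

(** One inequality for each set, its rank bound, and one for each coordinate, its nonnegativity; the
    equation for the coordinate sum is built into the chart. *)
Lemma chart_polyhedron : exists (T : finType) (c : T -> 'I_n -> R) (a : T -> R),
  chart_set = polyhedron c a.
Proof.
exists ({set 'I_N} + 'I_N)%type.
exists (fun (j : {set 'I_N} + 'I_N) i => match j with inl A => \sum_(l in A) B i l | inr l => - B i l end).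
exists (fun j : {set 'I_N} + 'I_N => match j with inl A => (rank M A)%:R - \sum_(l in A) b 0 l | inr l => b 0 l end).
have xE (t : n.-tuple R) l : (b + (\row_i tnth t i) *m B) 0 l = b 0 l + \sum_i B i l * tnth t i.
  by rewrite mxE; congr (_ + _); rewrite mxE; apply: eq_bigr => i _; rewrite mxE mulrC.
have sumE (t : n.-tuple R) (A : {set 'I_N}) :
    \sum_(l in A) [ffun l => (b + (\row_i tnth t i) *m B) 0 l] l =
    \sum_(l in A) b 0 l + \sum_i (\sum_(l in A) B i l) * tnth t i.
  under [RHS in _ = _ + RHS]eq_bigr do rewrite mulr_suml.
  rewrite exchange_big -big_split; apply: eq_bigr => l _.
  by rewrite ffunE xE.
apply/seteqP; split=> [t /base_polytopeP[x0 xA _] [A|l] /=|t h].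
- by rewrite lerBrDl -sumE.
- have := x0 l; rewrite ffunE xE; under [X in _ -> X <= _]eq_bigr do rewrite mulNr.
  by rewrite sumrN; lra.
apply/base_polytopeP; split=> [l|A|].
- have := h (inr l); rewrite ffunE xE /=; under eq_bigr do rewrite mulNr.
  by rewrite sumrN; lra.
- by have := h (inl A); rewrite sumE /= lerBrDl.
- by under eq_bigr do rewrite ffunE; rewrite (chart_sum chartB).
Qed.

(** A right inverse [D] of [B] recovers the chart coordinates from [x - b], whose entries are
    bounded because those of [x] lie in [[0, 1]]. *)
Lemma chart_bounded : exists K, chart_set `<=` cube K.
Proof.
have [/row_freeP[D BD] _ _] := chartB.
pose S := \sum_l \sum_i (1 + `|b 0 l|) * `|D l i|.
exists (Num.truncn S).+1 => t Pt i.
have /base_polytopeP xQ := Pt; have [x0 _ _] := xQ; have x1 := rank_polytope_le1 xQ.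
set x := b + _ in xQ x0 x1.
have ti : tnth t i = \sum_l (x 0 l - b 0 l) * D l i.
  have : (\row_i tnth t i) = (x - b) *m D by rewrite /x addrC addKr -mulmxA BD mulmx1.
  move=> /rowP/(_ i); rewrite !mxE => ->; apply: eq_bigr => l _.
  by rewrite [X in X * _]mxE [X in _ + X]mxE.
have leS : `|tnth t i| <= S.
  rewrite ti; apply: le_trans (ler_norm_sum _ _ _) _; apply: ler_sum => l _.
  rewrite (bigD1 i) //= normrM; apply: ler_wpDr.
    by apply: sumr_ge0 => j _; rewrite mulr_ge0 // addr_ge0.
  rewrite ler_wpM2r //; have := x0 l; have := x1 l; rewrite !ffunE => l1 l0.
  apply: le_trans (ler_normB _ _) _; rewrite lerD2r ger0_norm //.
have : S < (Num.truncn S).+1%:R by rewrite truncnS_gt.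
by rewrite -ler_norml => /ltW; apply: le_trans.
Qed.

Lemma chart_grid_count K k : (0 < k)%N -> chart_set `<=` cube K ->
  grid_count K k chart_set = #|rank_points d k M|.
Proof.
move=> k0 subK; have kR : 0 < k%:R :> R by rewrite ltr0n.
have kN0 : k%:R != 0 :> R by rewrite gt_eqF.
have [freeB _ _] := chartB.
rewrite grid_count_card.
pose pt (u : n.-tuple 'I_(grid_size K k)) : 'rV[R]_n := \row_i grid R K k (tnth u i).
have ptE (u : n.-tuple 'I_(grid_size K k)) : (\row_i tnth [tuple of map (fun i : 'I_(grid_size K k) => grid R K k i) u] i) = pt u.
  by apply/rowP => i; rewrite !mxE tnth_map.
have kpt u i : k%:R * pt u 0 i = (tnth u i)%:R - (K * k)%:R.
  by rewrite mxE /grid mulrC divfK.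
pose r (u : n.-tuple 'I_(grid_size K k)) (y : {ffun 'I_N -> 'I_k.+1}) :=
  forall l, (y l)%:R = k%:R * (b + pt u *m B) 0 l.
(* The dilated point is the chart image of [k v] plus the integral vector [(k - 1) b]; hence it is
   integral exactly when [k v] is. *)
have scaleE (v : 'rV[R]_n) l :
    k%:R * (b + v *m B) 0 l = (b + (k%:R *: v) *m B) 0 l + (k%:R - 1) * b 0 l.
  by rewrite -scalemxAl !mxE; ring.
apply: (card_eq_rel (r := r)).
- move=> u; rewrite inE => /asboolP; rewrite /chart_set /= ptE => Pu.
  have ix l : k%:R * (b + pt u *m B) 0 l \is a Num.int.
    rewrite scaleE rpredD ?rpredM ?rpredB ?natr_int ?rpred1 ?(chart_b_int chartB) //.
    apply: (chart_int chartB) => i; rewrite mxE kpt rpredB ?natr_int //.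
  have /base_polytopeP xQ := Pu; have [x0 _ _] := xQ; have x1 := rank_polytope_le1 xQ.
  have ny l : exists z : 'I_k.+1, z%:R = k%:R * (b + pt u *m B) 0 l.
    have xl0 := x0 l; have xl1 := x1 l; rewrite !ffunE in xl0 xl1.
    have /natrP[z ez] : k%:R * (b + pt u *m B) 0 l \is a Num.nat.
      by rewrite natrEint ix mulr_ge0.
    have ltz : (z < k.+1)%N by rewrite ltnS -(ler_nat R) -ez -[leRHS]mulr1 ler_pM2l.
    by exists (Ordinal ltz); rewrite ez.
  have [y yE] := choice ny.
  have ry : r u [ffun l => y l] by move=> l; rewrite ffunE yE.
  by exists [ffun l => y l] => //; apply/(rank_points_polytope k0 rM ry).
- move=> y yM; pose x : 'rV[R]_N := \row_l ((y l)%:R / k%:R).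
  have xy l : (y l)%:R = k%:R * x 0 l by rewrite mxE mulrC divfK.
  have Px : P x by apply/(rank_points_polytope k0 rM xy).
  have [v ev] : exists v, x = b + v *m B.
    apply: (chart_surj chartB); have /base_polytopeP[_ _ <-] := Px.
    by apply: eq_bigr => l _; rewrite ffunE.
  have iv i : (k%:R *: v) 0 i \is a Num.int.
    apply: (chart_int_inv chartB) => l.
    have : k%:R * (b + v *m B) 0 l - (k%:R - 1) * b 0 l \is a Num.int.
      by rewrite -ev -xy rpredB ?rpredM ?rpredB ?natr_int ?rpred1 ?(chart_b_int chartB).
    by rewrite scaleE addrK.
  have vK i : - K%:R <= v 0 i <= K%:R.
    have : cube K [tuple v 0 i | i < n].
      apply: subK; rewrite /chart_set /= (_ : \row_i _ = v) -?ev //.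
      by apply/rowP => j; rewrite mxE tnth_mktuple.
    by move=> /(_ i); rewrite tnth_mktuple.
  have nu i : exists z : 'I_(grid_size K k), grid R K k z = v 0 i.
    have /andP[v0 v1] := vK i.
    have iw : k%:R * v 0 i + (K * k)%:R \is a Num.int.
      by have := iv i; rewrite mxE => h; rewrite rpredD ?natr_int.
    have w0 : 0 <= k%:R * v 0 i + (K * k)%:R by rewrite mulnC natrM -mulrDr mulr_ge0 //; lra.
    have /natrP[z ez] : k%:R * v 0 i + (K * k)%:R \is a Num.nat by rewrite natrEint iw.
    have ltz : (z < grid_size K k)%N.
      by rewrite ltnS -(ler_nat R) -ez !natrM; have := ler_wpM2l (ltW kR) v1; lra.
    by exists (Ordinal ltz); rewrite /grid /= -ez addrK mulrC mulKf.
  have [u uE] := choice nu.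
  exists [tuple u i | i < n]; last first.
    move=> l; rewrite xy ev (_ : pt _ = v) //.
    by apply/rowP => i; rewrite mxE tnth_mktuple uE.
  rewrite inE; apply/asboolP; rewrite /chart_set /= ptE (_ : pt _ = v) -?ev //.
  by apply/rowP => i; rewrite mxE tnth_mktuple uE.
- move=> u u' y ru ru'; apply: eq_from_tnth => i; apply: val_inj => /=.
  have : pt u = pt u'.
    apply: (row_free_inj freeB); apply: (addrI b); apply/rowP => l.
    by apply: (mulfI kN0); rewrite -ru ru'.
  move=> /rowP/(_ i)/(congr1 ( *%R k%:R)); rewrite !kpt => /addIr/eqP.
  by rewrite eqr_nat => /eqP.
- move=> u y y' ry ry'; apply/ffunP => l; apply: val_inj => /=; apply/eqP.
  by rewrite -(eqr_nat R) ry ry'.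
Qed.

End ChartVolume.

End Charts.

(** * Passage to the limit *)

Lemma ffact_pred_le_exp n k : (k.-1 ^_ n <= k ^ n)%N.
Proof.
elim: n => [|n IH]; first by rewrite ffactn0 expn0.
by rewrite ffactnSr expnSr leq_mul //; lia.
Qed.

(** Each of the [n] factors falls short of [k] by at most [n], so the product loses at most
    [n^2 k^(n-1)]; multiplying by [k] avoids the exponent [n - 1]. *)
Lemma ffact_lower n k : (0 < k)%N -> (k ^ n * k <= k.-1 ^_ n * k + n ^ 2 * k ^ n)%N.
Proof.
move=> k0; elim: n => [|n IH]; first by rewrite expn0 ffactn0; lia.
have lef := ffact_pred_le_exp n k.
have step : (k ^ n.+1 <= k * (k ^ n - k.-1 ^_ n) + n.+1 * k.-1 ^_ n + k.-1 ^_ n.+1)%N.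
  rewrite ffactnSr expnS mulnBr.
  have : (k.-1 ^_ n * k <= k.-1 ^_ n * (n.+1 + (k.-1 - n)))%N by rewrite leq_mul //; lia.
  have : (k * k.-1 ^_ n <= k * k ^ n)%N by rewrite leq_mul.
  by rewrite mulnDr [(n.+1 * _)%N]mulnC [(k * k.-1 ^_ n)%N]mulnC; lia.
have h1 : (k * (k ^ n - k.-1 ^_ n) <= n ^ 2 * k ^ n)%N.
  by rewrite mulnBr leq_subLR mulnC [(k * _)%N]mulnC.
have h2 : (n.+1 * k.-1 ^_ n <= n.+1 * k ^ n)%N by rewrite leq_mul.
have h3 : (k ^ n.+1 <= k.-1 ^_ n.+1 + (n ^ 2 + n.+1) * k ^ n)%N by rewrite mulnDl; lia.
apply: leq_trans (leq_mul h3 (leqnn k)) _; rewrite mulnDl leq_add2l -mulnA -expnSr leq_mul //.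
by rewrite !expnS !expn0; nia.
Qed.

(** Takes the place of a limit: neither side depends on [k], so an explicit error [C / k] forces
    equality by the Archimedean property. *)
Lemma eq_of_dist_le (R : realType) (x y C : R) :
  (forall k : nat, (0 < k)%N -> `|x - y| <= C / k%:R) -> x = y.
Proof.
move=> h; apply/eqP; rewrite -subr_eq0 -normr_eq0 eq_le normr_ge0 andbT leNgt; apply/negP => d0.
have C0 : 0 <= C by have := h 1%N isT; rewrite divr1; apply: le_trans.
pose k := (Num.truncn (C / `|x - y|)).+1.
have := h k isT; rewrite ler_pdivlMr ?ltr0n // leNgt => /negP[].
rewrite mulrC -ltr_pdivrMr //; exact: truncnS_gt.
Qed.

Theorem theorem1p1 (R : realType) (n d : nat) (n_ge1 : (1 <= n)%N)
    (d_ge1 : (1 <= d)%N) (M : matroid 'I_n.+1) (M_connected : matroid_connected M)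
    (M_rank : matroid_rank M = d.+1) :
  normalised_volume (base_polytope R M) =
    ((n`!%:R)^-1 *
      (\sum_(F : anchored_chain M)
         chain_mu F * (delta_le d n (chain_bin F))%:Z)%:~R)%:E.
Proof.
rewrite /normalised_volume; set S := [set v | _].
(* A chart exists, so [xget] returns the volume in some chart and not its default 0; the computation
   below is carried out in that unspecified chart. *)
have : S (xget 0%E S).
  have [b0 chart0] := exists_lattice_chart R M_connected.
  by apply: (xgetI 0%E (x := chart_volume (base_polytope R M) b0 (std_frame R n))); exists n, b0, (std_frame R n).
move: (xget _ _) => _ [m [b [B [chartB ->]]]].
have mn := chart_dim M_connected chartB; subst m.
have [T [c [a setE]]] := chart_polyhedron M_connected chartB.
have [K subK] := chart_bounded chartB.
have [C C0 volP] := @polyhedron_volume R K n.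
rewrite /chart_volume; have countE k k0 := chart_grid_count M_connected chartB M_rank (k := k) k0 subK.
rewrite setE in subK countE *.
have {}volP k (k0 : (0 < k)%N) := volP k T c a k0 subK.
set V := lebesgue_volume _ in volP *.
(* The estimates at [k = 1] already exclude both infinite values. *)
have Vfin : V \is a fin_num.
  have [V1 V2] := volP 1%N isT; rewrite fin_numE; apply/andP; split; apply/eqP => eV.
    by move: V2; rewrite eV addNye leeNy_eq.
  by move: V1; rewrite eV leye_eq.
move: volP; rewrite -(fineK Vfin); move: (fine V) => v volP; congr _%:E.
(* The proportion of generic words among all words of length [n] over [k] letters; [w F] below is
   the limit of the normalised count for the chain [F]. *)
pose f k : R := (k.-1 ^_ n)%:R / k%:R ^+ n.
pose w (F : anchored_chain M) : R := (delta_le d n (chain_bin F))%:R / n`!%:R.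
pose D : R := \sum_(F : anchored_chain M) `|(chain_mu F)%:~R| * (w F + 2 ^+ n.+1).
have targetE : (n`!%:R)^-1 * (\sum_(F : anchored_chain M)
    chain_mu F * (delta_le d n (chain_bin F))%:Z)%:~R =
    \sum_(F : anchored_chain M) (chain_mu F)%:~R * w F :> R.
  rewrite raddf_sum mulr_sumr; apply: eq_bigr => F _ /=.
  by rewrite rmorphM /= -pmulrn /w mulrCA [_^-1 * _]mulrC.
(* The part [C] compares the volume with the grid count, and [n^2 * D] compares the weighted chain
   counts with their limits, since [1 - f k <= n^2 / k]. *)
rewrite targetE; apply: (@eq_of_dist_le _ _ _ (C + n%:R ^+ 2 * D)) => k k0.
have kR : 0 < k%:R :> R by rewrite ltr0n.
have knR : 0 < k%:R ^+ n :> R by rewrite exprn_gt0.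
have f1 : 1 - f k <= n%:R ^+ 2 / k%:R.
  have := ffact_lower n k0; rewrite -(ler_nat R) natrD !natrM !natrX => h.
  rewrite lerBlDr -(ler_pM2r knR) -(ler_pM2r kR) mul1r mulrDl.
  rewrite [f k * _]divfK ?gt_eqF // mulrDl addrC; apply: le_trans h _; rewrite lerD2l.
  by rewrite (_ : _ / _ * _ * _ = n%:R ^+ 2 * k%:R ^+ n) //; field; rewrite gt_eqF.
have f0 : 0 <= 1 - f k.
  by rewrite subr_ge0 ler_pdivrMr // mul1r -natrX ler_nat ffact_pred_le_exp.
have [V1 V2] := volP k k0; rewrite countE // in V1 V2.
rewrite lee_fin in V1; rewrite -EFinD lee_fin in V2.
have NE : #|rank_points d k M|%:R / k%:R ^+ n =
    \sum_(F : anchored_chain M) (chain_mu F)%:~R * (#|chain_points d k F|%:R / k%:R ^+ n) :> R.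
  have := congr1 (fun z : int => z%:~R / k%:R ^+ n : R) (card_rank_points k n_ge1 M_connected M_rank).
  rewrite -pmulrn raddf_sum mulr_suml => ->; apply: eq_bigr => F _ /=.
  by rewrite rmorphM /= -pmulrn -mulrA.
(* Generic words contribute [w F * f k], which misses [w F] by [(1 - f k) * w F]; the remaining
   points contribute at most [2^(n+1) * (1 - f k)]. *)
have chainE (F : anchored_chain M) : `|#|chain_points d k F|%:R / k%:R ^+ n - w F| <= (1 - f k) * (w F + 2 ^+ n.+1).
  have [g [e [-> ge le_e]]] := card_chain_points n_ge1 k0 M_rank F.
  have w0 : 0 <= w F by rewrite divr_ge0.
  have fact0 : n`!%:R != 0 :> R by rewrite pnatr_eq0 -lt0n fact_gt0.
  have gE : g%:R / k%:R ^+ n = w F * f k.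
    have : g%:R * n`!%:R = (delta_le d n (chain_bin F))%:R * (k.-1 ^_ n)%:R :> R.
      by rewrite -!natrM ge.
    move=> /(canRL (mulfK fact0)) ->; rewrite /w /f; field.
    by rewrite fact0 andbT gt_eqF.
  have eE : e%:R / k%:R ^+ n <= 2 ^+ n.+1 * (1 - f k).
    rewrite ler_pdivrMr // -mulrA mulrBl mul1r divfK ?gt_eqF //.
    by rewrite -!natrX -natrB ?ffact_pred_le_exp // -natrM ler_nat.
  have e0 : 0 <= e%:R / k%:R ^+ n :> R by rewrite divr_ge0 // ltW.
  rewrite natrD mulrDl gE; have := mulr_ge0 f0 w0; rewrite ler_norml => ?.
  have : 0 <= 2 ^+ n.+1 * (1 - f k) by rewrite mulr_ge0 // exprn_ge0.
  by move=> ?; apply/andP; split; nra.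
have sumP : `|\sum_(F : anchored_chain M) (chain_mu F)%:~R * (#|chain_points d k F|%:R / k%:R ^+ n) -
    \sum_(F : anchored_chain M) (chain_mu F)%:~R * w F| <= (1 - f k) * D.
  rewrite -sumrB /D mulr_sumr; apply: le_trans (ler_norm_sum _ _ _) _; apply: ler_sum => F _.
  by rewrite -mulrBr normrM mulrCA ler_wpM2l // chainE.
have D0 : 0 <= D.
  by apply: sumr_ge0 => F _; rewrite mulr_ge0 // addr_ge0 // ?exprn_ge0 // divr_ge0.
have : `|v - #|rank_points d k M|%:R / k%:R ^+ n| <= C / k%:R.
  by rewrite ler_distl; apply/andP; split; lra.
have := ler_wpM2r D0 f1; rewrite -NE in sumP => fD vN.
rewrite mulrDl; apply: le_trans (ler_distD (#|rank_points d k M|%:R / k%:R ^+ n) _ _) _.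
apply: lerD => //; apply: le_trans sumP _; apply: le_trans fD _.
by rewrite mulrAC.
Qed.
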